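(* Let $n\ge 1$. For any $0\leq u,v,w\leq n$, the structure constants $p^w_{u,v}\in R(T)$ of $K_T(\mathbb{P}^n)$ in the basis $\{\xi^u\}_{0\le u\le n}$, defined by $\xi^u\xi^v=\sum_{w=0}^n p^w_{u,v}\,\xi^w$, satisfy $$(-1)^{u+v+w}\, p^w_{u,v} = e^{\chi_{w+1}-\chi_{u+1}-\chi_{v+1}} \left[\frac{\prod_{i=1}^u (1-te^{\varepsilon_i})\ \prod_{i=1}^v (1-te^{\varepsilon_i})}{\prod_{i=1}^{w+1} (1-te^{\varepsilon_i})}\right]_{u+v-w+1},$$ where $[\,\cdot\,]_p$ denotes the coefficient of $t^p$ in the power series expansion at $t=0$.
   Context: Everything is over $\mathbb{C}$. $G=SL_{n+1}$, $T=\{(t_1,\dots,t_{n+1})\in(\mathbb{C}^* )^{n+1} : \prod t_i=1\}$ is its diagonal maximal torus, acting in the obvious way on $\mathbb{P}^n$ with projective coordinates $[x_1,\dots,x_{n+1}]$ (so $\mathbb{P}^n=G/P$ with $P$ the stabilizer of $[1,0,\dots,0]$). $R(T)$ is the representation ring of $T$, with $\mathbb{Z}$-basis the characters $e^\lambda$. The character $e^{\varepsilon_i}$ is $(t_1,\dots,t_{n+1})\mapsto t_i$, and $\chi_i=\varepsilon_1+\cdots+\varepsilon_i$ for $1\le i\le n+1$. For $0\le u\le n$ let $X^u=\{[0,\dots,0,x_{u+1},\dots,x_{n+1}]\}\subset\mathbb{P}^n$ (codimension $u$) and $X^{n+1}=\emptyset$. $K_T(\mathbb{P}^n)$ is the Grothendieck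 group of $T$-equivariant coherent sheaves on $\mathbb{P}^n$ (a ring, being also the Grothendieck group of $T$-equivariant vector bundles, with product induced by tensor product of vector bundles). Set $\xi^u=[\mathcal{O}_{X^u}]-[\mathcal{O}_{X^{u+1}}]$, the class of the ideal sheaf of $X^{u+1}$ in $X^u$; $\{\xi^u\}_{0\le u\le n}$ is an $R(T)$-basis of $K_T(\mathbb{P}^n)$. *)

(* Defs.v *)
From HB Require Import structures.
From mathcomp Require Import all_boot all_order all_algebra.
From mathcomp Require Import boolp classical_sets functions.

Set Implicit Arguments.
Unset Strict Implicit.
Unset Printing Implicit Defensive.

Import Order.TTheory GRing.Theory Num.Theory.
Local Open Scope ring_scope.

(* Conventions.  Coordinates are indexed by 'I_n.+1, so x_i (1 <= i <= n+1)
   has index i-1, and the condition i <= u becomes (i < u)%N.  A point of P^n is handled through its homogeneous coordinate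
   vectors; functions on P^n are functions of these vectors that are given by
   expressions of degree 0. *)

Section Torus.
Variables (k : fieldType) (n : nat).

Record torus := Torus {
  tval : 'rV[k]_n.+1;
  _ : \prod_i tval 0 i == 1 }.

HB.instance Definition _ := [isSub for tval].
HB.instance Definition _ := [Equality of torus by <:].
HB.instance Definition _ := [Choice of torus by <:].

Lemma torus_prod (t : torus) : \prod_i tval t 0 i = 1.
Proof. by case: t => x /= /eqP. Qed.

Lemma torus_neq0 (t : torus) i : tval t 0 i != 0.
Proof.
apply/eqP => ti0; have := torus_prod t.
by rewrite (bigD1 i) //= ti0 mul0r => /eqP; rewrite eq_sym oner_eq0.
Qed.

Lemma torus1_subproof : \prod_i (const_mx 1 : 'rV[k]_n.+1) 0 i == 1.
Proof. by rewrite big1 // => i _; rewrite mxE. Qed.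
Definition torus1 : torus := Torus torus1_subproof.

Lemma torusM_subproof (s t : torus) :
  \prod_i (\row_i (tval s 0 i * tval t 0 i) : 'rV[k]_n.+1) 0 i == 1.
Proof.
under eq_bigr do rewrite mxE.
by rewrite big_split /= !torus_prod mulr1.
Qed.
Definition torusM (s t : torus) : torus := Torus (torusM_subproof s t).

HB.instance Definition _ := isPointed.Build torus torus1.

(* x^m = x_1^{m_1} ... x_{n+1}^{m_{n+1}}; for t in T this is the value at t of
   the character m_1 eps_1 + ... + m_{n+1} eps_{n+1}. *)
Definition mon (m : 'rV[int]_n.+1) (x : 'rV[k]_n.+1) : k :=
  \prod_i (x 0 i) ^ (m 0 i).

Lemma mon0 x : mon 0 x = 1.
Proof. by rewrite /mon big1 // => i _; rewrite mxE expr0z. Qed.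

Lemma mon_torusD (l m : 'rV[int]_n.+1) (t : torus) :
  mon (l + m) (tval t) = mon l (tval t) * mon m (tval t).
Proof.
rewrite /mon -big_split /=; apply: eq_bigr => i _.
by rewrite mxE expfzDr ?torus_neq0.
Qed.

Lemma mon_one m : mon m (tval torus1) = 1.
Proof. by rewrite /mon big1 // => i _; rewrite mxE exp1rz. Qed.

Lemma mon_torusM m (s t : torus) :
  mon m (tval (torusM s t)) = mon m (tval s) * mon m (tval t).
Proof.
rewrite /mon -big_split /=; apply: eq_bigr => i _.
by rewrite mxE expfzMl.
Qed.

(* R(T) is realised as the ring of virtual characters of T: the integral
   combinations of the characters, inside the ring of functions T -> k. *)
Definition virtual_character : {pred torus -> k} := fun f =>
  `[< exists s : seq (int * 'rV[int]_n.+1),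
        forall t, f t = \sum_(c <- s) c.1%:~R * mon c.2 (tval t) >].

Lemma virtual_character_subring : subring_closed virtual_character.
Proof.
split=> [|f g|f g].
- apply/asboolP; exists [:: (1, 0)] => t.
  by rewrite big_seq1 /= mon0 mulr1.
- move=> /asboolP[s fs] /asboolP[s' gs]; apply/asboolP.
  exists (s ++ [seq (- c.1, c.2) | c <- s']) => t.
  rewrite big_cat big_map /= [LHS](_ : _ = f t - g t) // fs gs; congr (_ + _).
  by rewrite -sumrN; apply: eq_bigr => c _; rewrite mulrNz mulNr.
- move=> /asboolP[s fs] /asboolP[s' gs]; apply/asboolP.
  exists [seq (c.1 * c'.1, c.2 + c'.2) | c <- s, c' <- s'] => t.
  rewrite big_allpairs_dep [LHS](_ : _ = f t * g t) // fs gs big_distrlr /=; apply: eq_bigr => c _.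
  apply: eq_bigr => c' _.
  by rewrite mon_torusD intrM mulrACA.
Qed.

HB.instance Definition _ :=
  GRing.isSubringClosed.Build (torus -> k) virtual_character
    virtual_character_subring.

Record RT := MkRT {
  RTval : torus -> k;
  _ : RTval \in virtual_character }.

HB.instance Definition _ := [isSub for RTval].
HB.instance Definition _ := [Equality of RT by <:].
HB.instance Definition _ := [Choice of RT by <:].
HB.instance Definition _ := [SubChoice_isSubComNzRing of RT by <:].

Lemma RTchar_subproof (l : 'rV[int]_n.+1) :
  (fun t => mon l (tval t)) \in virtual_character.
Proof.
by apply/asboolP; exists [:: (1, l)] => t; rewrite big_seq1 /= mul1r.
Qed.

Definition RTchar (l : 'rV[int]_n.+1) : RT := MkRT (RTchar_subproof l).

End Torus.

(* Weights are written in Z^{n+1}, which surjects onto X(T); [eps i] with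
   i : 'I_n.+1 and [chi j] = eps_1 + ... + eps_j. *)
Definition eps n (i : 'I_n.+1) : 'rV[int]_n.+1 := delta_mx 0 i.
Definition chi n (j : nat) : 'rV[int]_n.+1 := \sum_(i < n.+1 | (i < j)%N) eps i.

Section Charts.
Variables (k : fieldType) (n : nat).

(* A nonempty I stands for the T-stable affine open set
   U_I = {x_i <> 0 for all i in I} of P^n. *)
Record chart := Chart { cset :> {set 'I_n.+1}; _ : cset != finset.set0 }.

(* Homogeneous coordinate vectors of the points of X^u /\ U_I.  Every I is
   nonempty, so the zero vector is excluded; X^0 = P^n and X^(n+1) is empty. *)
Definition in_chart (u : nat) (I : chart) (x : 'rV[k]_n.+1) : bool :=
  [forall i : 'I_n.+1, (i < u)%N ==> (x 0 i == 0)]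
  && [forall i in cset I, x 0 i != 0].

Definition pt u I := {x : 'rV[k]_n.+1 | in_chart u I x}.

(* The Laurent monomials that are regular on U_I: degree 0, and negative
   exponents only at the coordinates that do not vanish there. *)
Definition allowed (I : chart) (m : 'rV[int]_n.+1) : bool :=
  (\sum_i m 0 i == 0) && [forall j, (j \notin cset I) ==> (0 <= m 0 j)].

(* Regular functions on X^u /\ U_I, i.e. restrictions of elements of
   k[U_I] = k[x_j / x_i | i in I]. *)
Definition regular u I : {pred pt u I -> k} := fun f =>
  `[< exists s : seq (k * 'rV[int]_n.+1),
        all (fun c => allowed I c.2) s
        /\ forall x, f x = \sum_(c <- s) c.1 * mon c.2 (val x) >].

Lemma allowed0 I : allowed I 0.
Proof.
apply/andP; split; first by rewrite big1 // => i _; rewrite mxE.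
by apply/forallP => j; rewrite mxE lexx implybT.
Qed.

Lemma allowedD I l m : allowed I l -> allowed I m -> allowed I (l + m).
Proof.
move=> /andP[/eqP l0 /forallP lp] /andP[/eqP m0 /forallP mp].
apply/andP; split.
  by under eq_bigr do rewrite mxE; rewrite big_split /= l0 m0 addr0.
apply/forallP => j; apply/implyP => jI; rewrite mxE.
by rewrite addr_ge0 ?(implyP (lp j)) ?(implyP (mp j)).
Qed.

Lemma allowedS (I J : chart) m : cset I \subset cset J -> allowed I m -> allowed J m.
Proof.
move=> IJ /andP[m0 /forallP mp]; rewrite /allowed m0 /=.
apply/forallP => j; apply/implyP => jJ; apply: (implyP (mp j)).
by apply: contraNN jJ; apply: (fintype.subsetP IJ).
Qed.

Lemma monD u I l m (x : pt u I) : allowed I l -> allowed I m ->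
  mon (l + m) (val x) = mon l (val x) * mon m (val x).
Proof.
move=> /andP[_ /forallP lp] /andP[_ /forallP mp].
rewrite /mon -big_split /=; apply: eq_bigr => i _; rewrite mxE.
have [iI|iI] := boolP (i \in cset I).
  apply: expfzDr; have /andP[_ /forallP/(_ i)] := valP x.
  by move/implyP/(_ iI).
have := implyP (lp i) iI; have := implyP (mp i) iI.
by case: (l 0 i) => // a; case: (m 0 i) => // b _ _; rewrite -PoszD -!exprnP exprD.
Qed.

Lemma regular_subring u I : subring_closed (@regular u I).
Proof.
split=> [|f g|f g].
- apply/asboolP; exists [:: (1, 0)]; split; first by rewrite /= allowed0.
  by move=> x; rewrite big_seq1 /= mon0 mulr1.
- move=> /asboolP[s [sI fs]] /asboolP[s' [s'I gs]]; apply/asboolP.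
  exists (s ++ [seq (- c.1, c.2) | c <- s']); split.
    by rewrite all_cat sI all_map.
  move=> x; rewrite big_cat big_map /= [LHS](_ : _ = f x - g x) // fs gs; congr (_ + _).
  by rewrite -sumrN; apply: eq_bigr => c _; rewrite mulNr.
- move=> /asboolP[s [sI fs]] /asboolP[s' [s'I gs]]; apply/asboolP.
  exists [seq (c.1 * c'.1, c.2 + c'.2) | c <- s, c' <- s']; split.
    apply/allP => _ /allpairsP[[c c'] /= [cs cs' ->]] /=.
    exact: allowedD (allP sI _ cs) (allP s'I _ cs').
  move=> x; rewrite big_allpairs_dep [LHS](_ : _ = f x * g x) // fs gs big_distrlr /=.
  apply: eq_big_seq => c cs; apply: eq_big_seq => c' cs'.
  by rewrite (monD x (allP sI _ cs) (allP s'I _ cs')) mulrACA.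
Qed.

HB.instance Definition _ u I :=
  GRing.isSubringClosed.Build (pt u I -> k) (@regular u I) (@regular_subring u I).

Record reg (u : nat) (I : chart) := Reg {
  rval : pt u I -> k;
  _ : rval \in @regular u I }.

HB.instance Definition _ u I := [isSub for (@rval u I)].
HB.instance Definition _ u I := [Equality of reg u I by <:].
HB.instance Definition _ u I := [Choice of reg u I by <:].
HB.instance Definition _ u I := GRing.SubChoice_isSubComPzRing.Build
  (pt u I -> k) (@regular u I) (reg u I) (@regular_subring u I).

Lemma regP u I (f g : reg u I) : (forall x, rval f x = rval g x) <-> f = g.
Proof. by split=> [fg|->//]; apply/val_inj/funext. Qed.

Lemma rvalD u I (f g : reg u I) x : rval (f + g) x = rval f x + rval g x.
Proof. by []. Qed.
Lemma rvalM u I (f g : reg u I) x : rval (f * g) x = rval f x * rval g x.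
Proof. by []. Qed.
Lemma rval1 u I x : rval (1 : reg u I) x = 1.
Proof. by []. Qed.
Lemma rval0 u I x : rval (0 : reg u I) x = 0.
Proof. by []. Qed.
Lemma rvalX u I (f : reg u I) N x : rval (f ^+ N) x = rval f x ^+ N.
Proof. by elim: N => [|N IHN]; rewrite ?expr0 // !exprS rvalM IHN. Qed.

Lemma rval_sum u I T (s : seq T) (F : T -> reg u I) x :
  rval (\sum_(i <- s) F i) x = \sum_(i <- s) rval (F i) x.
Proof. by elim/big_rec2: _ => // i y z _ <-. Qed.

Lemma pt_incl_subproof u v (I J : chart) (le : (u <= v)%N && (cset I \subset cset J))
  (x : pt v J) : in_chart u I (val x).
Proof.
have /andP[uv IJ] := le; have /andP[/forallP x0 /forallP xJ] := valP x.
apply/andP; split; apply/forallP => i; apply/implyP => iP.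
  by apply: (implyP (x0 i)); apply: leq_trans uv.
by apply: (implyP (xJ i)); apply: (fintype.subsetP IJ).
Qed.

Definition pt_incl u v (I J : chart) (le : (u <= v)%N && (cset I \subset cset J))
  (x : pt v J) : pt u I := Sub (val x) (pt_incl_subproof le x).

Lemma restr_subproof u v (I J : chart) (le : (u <= v)%N && (cset I \subset cset J))
  (f : reg u I) : (rval f \o pt_incl le) \in @regular v J.
Proof.
have /andP[uv IJ] := le; case: f => f /= /asboolP[s [sI fs]].
apply/asboolP; exists s; split.
  by apply: sub_all sI => c; apply: allowedS.
by move=> x; rewrite /= fs.
Qed.

Definition restr u v (I J : chart) (le : (u <= v)%N && (cset I \subset cset J))
  (f : reg u I) : reg v J := Reg (restr_subproof le f).

Lemma leI (I J : chart) (IJ : cset I \subset cset J) u :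
  (u <= u)%N && (cset I \subset cset J).
Proof. by rewrite leqnn. Qed.

Lemma leu u (I : chart) : (0 <= u)%N && (cset I \subset cset I).
Proof. by rewrite leq0n /=. Qed.

(* k[U_I], the ring of sections of O_{P^n} over U_I *)
Definition A I := reg 0 I.
HB.instance Definition _ I := GRing.ComPzRing.on (A I).

Definition restrA (I J : chart) (IJ : cset I \subset cset J) (a : A I) : A J :=
  restr (leI IJ 0) a.

Lemma cstA_subproof I (c : k) : (fun=> c) \in @regular 0 I.
Proof.
apply/asboolP; exists [:: (c, 0)]; split; first by rewrite /= allowed0.
by move=> x; rewrite big_seq1 /= mon0 mulr1.
Qed.

Definition cstA I (c : k) : A I := Reg (cstA_subproof I c).

Lemma monA_subproof u I (m : 'rV[int]_n.+1) (mI : allowed I m) :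
  (fun x : pt u I => mon m (val x)) \in @regular u I.
Proof.
apply/asboolP; exists [:: (1, m)]; split; first by rewrite /= mI.
by move=> x; rewrite big_seq1 /= mul1r.
Qed.

Definition dexp (i : 'I_n.+1) (J : chart) : 'rV[int]_n.+1 :=
  \sum_(j in cset J) (eps j - eps i).

Lemma dexpE i J j :
  dexp i J 0 j = (j \in cset J)%:Z - (j == i)%:Z * #|cset J|%:Z.
Proof.
rewrite /dexp summxE.
under eq_bigr => l _ do rewrite !mxE !eqxx /=.
rewrite big_split /= sumr_const -mulNrn; congr (_ + _).
  have [jJ|jJ] := boolP (j \in cset J).
    rewrite (bigD1 j) //= eqxx big1 ?addr0 // => l /andP[_ lj].
    by rewrite eq_sym (negPf lj).
  by rewrite big1 // => l lJ; case: eqP => // jl; rewrite jl lJ in jJ.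
case: (j == i); first by rewrite mul1r mulr1n mulNrn natz.
by rewrite mulr0n mul0rn mul0r oppr0.
Qed.

Lemma dexp_allowed (I J : chart) i : i \in cset I -> allowed I (dexp i J).
Proof.
move=> iI; apply/andP; split.
  under eq_bigr do rewrite /dexp summxE.
  rewrite exchange_big /= big1 // => j _.
  under eq_bigr do rewrite !mxE !eqxx /=.
  rewrite big_split /= sumrN (bigD1 j) //= eqxx.
  rewrite big1 ?addr0 => [|l /negPf-> //]; rewrite (bigD1 i) //= eqxx.
  by rewrite big1 ?addr0 ?subrr // => l /negPf->.
apply/forallP => j; apply/implyP => jI; rewrite dexpE.
have /negPf-> : j != i by apply: contraNneq jI => ->.
by rewrite mul0r subr0.
Qed.

(* For I \subset J and i in I, U_J is the principal open set of U_I defined by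
   the function (prod_(j in J) x_j) / x_i^|J|. *)
Definition denom (I J : chart) i (iI : i \in cset I) : A I :=
  Reg (monA_subproof 0 (dexp_allowed J iI)).

(* (t . f)(x) = f(t^-1 x) *)
Lemma ptV_subproof u I (t : torus k n) (x : pt u I) :
  in_chart u I (\row_i ((tval t 0 i)^-1 * val x 0 i)).
Proof.
have /andP[/forallP x0 /forallP xI] := valP x.
apply/andP; split; apply/forallP => i; apply/implyP => iP; rewrite mxE.
  by rewrite (eqP (implyP (x0 i) iP)) mulr0.
by rewrite mulf_neq0 ?invr_eq0 ?torus_neq0 ?(implyP (xI i) iP).
Qed.

Definition ptV u I (t : torus k n) (x : pt u I) : pt u I :=
  Sub _ (ptV_subproof t x).

Lemma mon_ptV u I m (t : torus k n) (x : pt u I) :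
  mon m (val (ptV t x)) = mon (- m) (tval t) * mon m (val x).
Proof.
rewrite /mon -big_split /=; apply: eq_bigr => i _.
by rewrite !mxE expfzMl exprz_inv.
Qed.

Lemma tactR_subproof u I (t : torus k n) (f : reg u I) :
  (rval f \o ptV t) \in @regular u I.
Proof.
case: f => f /= /asboolP[s [sI fs]]; apply/asboolP.
exists [seq (c.1 * mon (- c.2) (tval t), c.2) | c <- s]; split.
  by rewrite all_map.
move=> x; rewrite /= fs big_map; apply: eq_bigr => c _ /=.
by rewrite mon_ptV mulrA.
Qed.

Definition tactR u I (t : torus k n) (f : reg u I) : reg u I :=
  Reg (tactR_subproof t f).

(* The O_{P^n}(U_I)-module structure of O_{X^u}(U_I) *)
Definition reg_scale u I (a : A I) (f : reg u I) : reg u I :=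
  restr (leu u I) a * f.

Lemma reg_scalerA u I (a b : A I) (f : reg u I) :
  reg_scale a (reg_scale b f) = reg_scale (a * b) f.
Proof. by apply/regP => x; rewrite !rvalM /= mulrA. Qed.
Lemma reg_scale1r u I : left_id 1 (@reg_scale u I).
Proof. by move=> f; apply/regP => x; rewrite !rvalM /= mul1r. Qed.
Lemma reg_scalerDr u I : right_distributive (@reg_scale u I) +%R.
Proof. by move=> a f g; rewrite /reg_scale mulrDr. Qed.
Lemma reg_scalerDl u I (f : reg u I) :
  {morph (fun a => reg_scale a f) : a b / a + b}.
Proof. by move=> a b; apply/regP => x; rewrite rvalD !rvalM /= mulrDl. Qed.

HB.instance Definition _ u I := GRing.Zmodule_isLmodule.Build (A I) (reg u I)
  (@reg_scalerA u I) (@reg_scale1r u I) (@reg_scalerDr u I) (@reg_scalerDl u I).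

End Charts.

Arguments restrA {k n I J} IJ a.
Arguments denom {k n I} J {i} iI.
Arguments cstA {k n} I c.

Definition finitely_generated (B : pzRingType) (M : lmodType B) : Prop :=
  exists (r : nat) (b : 'I_r -> M),
    forall m, exists c : 'I_r -> B, m = \sum_i c i *: b i.

(* M_g is free over B_g.  A basis of M_g can be rescaled into the image of M,
   hence the formulation without fractions. *)
Definition free_away (B : comPzRingType) (M : lmodType B) (g : B) : Prop :=
  exists (r : nat) (b : 'I_r -> M),
    (forall m, exists (N : nat) (c : 'I_r -> B), g ^+ N *: m = \sum_i c i *: b i)
    /\ (forall c : 'I_r -> B, \sum_i c i *: b i = 0 ->
          exists N : nat, forall i, g ^+ N * c i = 0).

(* Spec B is covered by principal open sets on which M is free of finite rank. *)
Definition locally_free (B : comPzRingType) (M : lmodType B) : Prop :=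
  exists (q : nat) (g c : 'I_q -> B),
    \sum_i c i * g i = 1 /\ forall i, free_away M (g i).

Section Sheaves.
Variables (k : fieldType) (n : nat).

(* A T-equivariant coherent sheaf on P^n, given by its sections over the
   T-stable affine open sets U_I (the charts x_i <> 0 and their intersections):
   - finitely generated k[U_I]-modules with restriction maps;
   - [res_ker], [res_im]: for U_J \subset U_I, the module over U_J is the
     localisation of the module over U_I at the equation of U_J in U_I;
   - a linearisation: T acts on sections, compatibly with its action on
     functions and with restriction, and each section over U_I lies in an
     algebraic finite dimensional representation, i.e. t . s is a combination
     of finitely many fixed sections with coefficients regular in t. *)
Record eqcoh := EqCoh {
  sec :> forall I : chart n, lmodType (A k I);
  res : forall I J : chart n, cset I \subset cset J -> sec I -> sec J;
  res_linear : forall (I J : chart n) (IJ : cset I \subset cset J) a s s',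
    res IJ (a *: s + s') = restrA IJ a *: res IJ s + res IJ s';
  res_id : forall (I : chart n) (II : cset I \subset cset I) s, res II s = s;
  res_comp : forall (I J L : chart n) (IJ : cset I \subset cset J)
    (JL : cset J \subset cset L) (IL : cset I \subset cset L) s,
    res JL (res IJ s) = res IL s;
  res_ker : forall (I J : chart n) (IJ : cset I \subset cset J) i (iI : i \in cset I) s,
    res IJ s = 0 -> exists N : nat, denom J iI ^+ N *: s = 0;
  res_im : forall (I J : chart n) (IJ : cset I \subset cset J) i (iI : i \in cset I)
    (s : sec J), exists (N : nat) (s' : sec I),
      res IJ s' = restrA IJ (denom J iI) ^+ N *: s;
  sec_fg : forall I, finitely_generated (sec I);
  act : torus k n -> forall I, sec I -> sec I;
  act_semilinear : forall t I a s s',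
    act t (a *: s + s') = tactR t a *: act t s + act t s' :> sec I;
  act1 : forall I (s : sec I), act (torus1 k n) s = s;
  actM : forall t t' I (s : sec I), act (torusM t t') s = act t (act t' s);
  act_res : forall t (I J : chart n) (IJ : cset I \subset cset J) s,
    act t (res IJ s) = res IJ (act t s);
  act_rational : forall I (s : sec I),
    exists w : seq ('rV[int]_n.+1 * sec I),
      forall t, act t s = \sum_(c <- w) cstA I (mon c.1 (tval t)) *: c.2 }.

Arguments res E {I J} IJ s : rename.
Arguments act E t {I} s : rename.

Definition is_hom (E F : eqcoh) (f : forall I, E I -> F I) : Prop :=
  [/\ forall I a (s s' : E I), f I (a *: s + s') = a *: f I s + f I s',
      forall I J (IJ : cset I \subset cset J) s, f J (res E IJ s) = res F IJ (f I s)
    & forall t I s, f I (act E t s) = act F t (f I s)].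

(* 0 -> E -> F -> G -> 0 *)
Definition short_exact (E F G : eqcoh) : Prop :=
  exists (f : forall I, E I -> F I) (g : forall I, F I -> G I),
    [/\ is_hom f, is_hom g & forall I,
      [/\ injective (f I),
          forall s, g I s = 0 <-> exists s', f I s' = s
        & forall s, exists s', g I s' = s]].

Definition vector_bundle (E : eqcoh) : Prop := forall I, locally_free (E I).

Definition is_linear (B : pzRingType) (M P : lmodType B) (f : M -> P) : Prop :=
  forall a s s', f (a *: s + s') = a *: f s + f s'.

Definition is_bilinear (B : comPzRingType) (M N P : lmodType B)
    (f : M -> N -> P) : Prop :=
  (forall m, is_linear (f m)) /\ (forall m', is_linear (fun m => f m m')).

Definition is_tensor (E F H : eqcoh) : Prop :=
  exists b : forall I, E I -> F I -> H I,
    [/\ forall I, is_bilinear (b I),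
        forall I J (IJ : cset I \subset cset J) s s',
          res H IJ (b I s s') = b J (res E IJ s) (res F IJ s'),
        forall t I s s', act H t (b I s s') = b I (act E t s) (act F t s')
      & forall I (P : lmodType (A k I)) (c : E I -> F I -> P), is_bilinear c ->
          exists! l : H I -> P, is_linear l /\ forall s s', l (b I s s') = c s s'].

(* E tensored with the character l of T *)
Section Twist.
Variables (l : 'rV[int]_n.+1) (E : eqcoh).

Definition twist_act (t : torus k n) I (s : E I) : E I :=
  cstA I (mon l (tval t)) *: act E t s.

Lemma cstAM (I : chart n) (c d : k) : cstA I c * cstA I d = cstA I (c * d).
Proof. by apply/regP. Qed.

Lemma tactR_cst t (I : chart n) (c : k) : tactR t (cstA I c) = cstA I c.
Proof. by apply/regP. Qed.

Lemma actZ t I a (s : E I) : act E t (a *: s) = tactR t a *: act E t s.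
Proof.
have a0 : act E t (0 : E I) = 0.
  have := act_semilinear (e := E) t (1 : A k I) 0 0.
  rewrite !scaler0 addr0.
  have -> : tactR t (1 : A k I) = 1 by apply/regP.
  by rewrite scale1r -[X in X = _]addr0 => /addrI.
by have := act_semilinear t a s 0; rewrite a0 !addr0.
Qed.

Lemma resZ I J (IJ : cset I \subset cset J) a (s : E I) :
  res E IJ (a *: s) = restrA IJ a *: res E IJ s.
Proof.
have a0 : res E IJ (0 : E I) = 0.
  have := res_linear (e := E) IJ (1 : A k I) 0 0.
  rewrite !scaler0 addr0.
  have -> : restrA IJ (1 : A k I) = 1 by apply/regP.
  by rewrite scale1r -[X in X = _]addr0 => /addrI.
by have := res_linear IJ a s 0; rewrite a0 !addr0.
Qed.

Lemma twist_semilinear t I a s s' :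
  twist_act t (a *: s + s') = tactR t a *: twist_act t s + twist_act t s' :> E I.
Proof.
rewrite /twist_act act_semilinear scalerDr !scalerA.
by congr (_ *: _ + _); apply: mulrC.
Qed.

Lemma twist_act1 I (s : E I) : twist_act (torus1 k n) s = s.
Proof.
rewrite /twist_act act1 mon_one.
have -> : cstA I (1 : k) = 1 by apply/regP.
exact: scale1r.
Qed.

Lemma twist_actM t t' I (s : E I) :
  twist_act (torusM t t') s = twist_act t (twist_act t' s).
Proof.
by rewrite /twist_act actM actZ tactR_cst scalerA cstAM mon_torusM.
Qed.

Lemma twist_act_res t (I J : chart n) (IJ : cset I \subset cset J) s :
  twist_act t (res E IJ s) = res E IJ (twist_act t s).
Proof. by rewrite /twist_act act_res resZ; congr (_ *: _); apply/regP. Qed.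

Lemma twist_rational I (s : E I) :
  exists w : seq ('rV[int]_n.+1 * E I),
    forall t, twist_act t s = \sum_(c <- w) cstA I (mon c.1 (tval t)) *: c.2.
Proof.
have [w ws] := act_rational s.
exists [seq (l + c.1, c.2) | c <- w] => t.
rewrite big_map /twist_act ws scaler_sumr; apply: eq_bigr => c _ /=.
by rewrite scalerA cstAM mon_torusD.
Qed.

Definition twist : eqcoh := EqCoh (@res_linear E) (@res_id E) (@res_comp E)
  (@res_ker E) (@res_im E) (@sec_fg E) twist_semilinear twist_act1 twist_actM
  twist_act_res twist_rational.
End Twist.

(* The structure sheaf of X^u *)
Section StructureSheaf.
Variable u : nat.

Definition OX_res (I J : chart n) (IJ : cset I \subset cset J) (s : reg k u I) :
  reg k u J := restr (leI IJ u) s.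

Lemma reg_scaleE (I : chart n) (a : A k I) (s : reg k u I) x :
  rval (a *: s) x = rval a (pt_incl (leu u I) x) * rval s x.
Proof. by []. Qed.

Lemma OX_res_linear (I J : chart n) (IJ : cset I \subset cset J) a s s' :
  OX_res IJ (a *: s + s') = restrA IJ a *: OX_res IJ s + OX_res IJ s'.
Proof.
apply/regP => x; rewrite !rvalD !reg_scaleE /=; congr (_ * _ + _).
by congr (rval a _); apply: val_inj.
Qed.

Lemma OX_res_id (I : chart n) (II : cset I \subset cset I) (s : reg k u I) :
  OX_res II s = s.
Proof. by apply/regP => x /=; congr (rval s _); apply: val_inj. Qed.

Lemma OX_res_comp (I J L : chart n) (IJ : cset I \subset cset J)
  (JL : cset J \subset cset L) (IL : cset I \subset cset L) s :
  OX_res JL (OX_res IJ s) = OX_res IL s.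
Proof. by apply/regP => x /=; congr (rval s _); apply: val_inj. Qed.

Lemma denomE (I J : chart n) i (iI : i \in cset I) (x : pt k 0 I) :
  rval (denom J iI) x = \prod_(j in cset J) (val x 0 j / val x 0 i).
Proof.
rewrite /= /mon.
have xi : val x 0 i != 0.
  by have /andP[_ /forallP/(_ i)/implyP/(_ iI)] := valP x.
under eq_bigr => j _ do rewrite dexpE.
rewrite big_split /= prodr_const.
transitivity ((\prod_j val x 0 j ^ (j \in cset J)%:Z) *
              (\prod_j val x 0 j ^ (- ((j == i)%:Z * #|cset J|%:Z)))).
  rewrite -big_split /=; apply: eq_bigr => j _.
  have [->|ji] := eqVneq j i; first by rewrite expfzDr.
  by rewrite mul0r oppr0 addr0 expr0z mulr1.
congr (_ * _).
  rewrite [RHS]big_mkcond /=; apply: eq_bigr => j _.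
  by case: (j \in cset J); rewrite ?expr1z ?expr0z.
rewrite (bigD1 i) //= eqxx mul1r big1 ?mulr1; last first.
  by move=> j /negPf->; rewrite mul0r oppr0 expr0z.
by rewrite -exprz_inv -exprnP.
Qed.

Lemma OX_res_ker (I J : chart n) (IJ : cset I \subset cset J) i (iI : i \in cset I)
  (s : reg k u I) :
  OX_res IJ s = 0 -> exists N : nat, denom J iI ^+ N *: s = 0.
Proof.
move=> s0; exists 1%N; apply/regP => x; rewrite expr1 reg_scaleE denomE rval0 /=.
have [xJ|] := boolP (in_chart u J (val x)).
  have := congr1 (fun f => rval f (Sub (val x) xJ)) s0.
  rewrite rval0 /= => sx.
  have -> : rval s x = 0 by rewrite -sx; congr (rval s _); apply: val_inj.
  by rewrite mulr0.
have /andP[xu _] := valP x.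
rewrite negb_and xu /= negb_forall => /existsP[j].
rewrite negb_imply negbK => /andP[jJ /eqP xj0].
by rewrite (bigD1 j) //= xj0 !mul0r.
Qed.

Lemma OX_res_im (I J : chart n) (IJ : cset I \subset cset J) i (iI : i \in cset I)
  (s : reg k u J) : exists (N : nat) (s' : reg k u I),
    OX_res IJ s' = restrA IJ (denom J iI) ^+ N *: s.
Proof.
have [w [wJ sw]] : exists w : seq (k * 'rV[int]_n.+1),
  all (fun c => allowed J c.2) w /\
  forall x, rval s x = \sum_(c <- w) c.1 * mon c.2 (val x).
  by case: s => f /= /asboolP.
have dJ : allowed J (dexp i J) by apply: dexp_allowed; apply: (fintype.subsetP IJ).
have dNJ N : allowed J (dexp i J *+ N).
  by elim: N => [|N IHN]; rewrite ?allowed0 // mulrS allowedD.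
pose N := \max_(c <- w) \max_(j < n.+1) absz (c.2 ord0 j).
have wI : all (fun c => allowed I c.2) [seq (c.1, c.2 + dexp i J *+ N) | c <- w].
  apply/allP => _ /mapP[c cw ->] /=.
  have cJ := allP wJ _ cw.
  have /andP[c0 _] := allowedD cJ (dNJ N); rewrite /allowed c0 /=.
  apply/forallP => j; apply/implyP => jI; rewrite mxE.
  have -> : (dexp i J *+ N) 0 j = dexp i J 0 j *+ N.
    by elim: (N) => [|M IHM]; rewrite ?mulr0n ?mxE // !mulrS mxE IHM.
  rewrite dexpE.
  have /negPf-> : j != i by apply: contraNneq jI => ->.
  rewrite mul0r subr0; have [jJ|jJ] := boolP (j \in cset J); last first.
    have /andP[_ /forallP/(_ j)/implyP/(_ jJ) cj] := cJ.
    by rewrite mul0rn addr0.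
  have : (absz (c.2 ord0 j) <= N)%N.
    apply: (@leq_trans (\max_(j < n.+1) absz (c.2 ord0 j))); first exact: (leq_bigmax j).
    by rewrite /N (big_rem c) //= leq_maxl.
  rewrite -lez_nat abszE => cN; rewrite natz addrC -[c.2 0 j]opprK subr_ge0.
  by apply: le_trans cN; rewrite -normrN ler_norm.
have fI : (fun x : pt k u I => \sum_(c <- [seq (c.1, c.2 + dexp i J *+ N) | c <- w])
    c.1 * mon c.2 (val x)) \in @regular k n u I.
  by apply/asboolP; eexists; split; first exact: wI.
exists N, (Reg fI); apply/regP => x; rewrite reg_scaleE rvalX /= sw.
rewrite big_map mulr_sumr; apply: eq_big_seq => c cw /=.
rewrite (@monD _ _ u J) ?(allP wJ) // mulrA [RHS]mulrC; congr (_ * _).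
elim: (N) => [|M IHM]; first by rewrite mulr0n mon0.
by rewrite mulrS (@monD _ _ u J) // exprS IHM.
Qed.

Lemma OX_fg (I : chart n) : finitely_generated (reg k u I : lmodType (A k I)).
Proof.
exists 1%N, (fun=> 1) => f.
have [w [wI sw]] : exists w : seq (k * 'rV[int]_n.+1),
  all (fun c => allowed I c.2) w /\
  forall x, rval f x = \sum_(c <- w) c.1 * mon c.2 (val x).
  by case: f => f /= /asboolP.
have gI : (fun x : pt k 0 I => \sum_(c <- w) c.1 * mon c.2 (val x))
  \in @regular k n 0 I by apply/asboolP; exists w.
exists (fun=> Reg gI); rewrite big_ord1.
by apply/regP => x; rewrite reg_scaleE rval1 mulr1 /= sw.
Qed.

Lemma OX_semilinear t (I : chart n) (a : A k I) (s s' : reg k u I) :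
  tactR t (a *: s + s') = tactR t a *: tactR t s + tactR t s'.
Proof.
apply/regP => x; rewrite [LHS](_ : _ = rval (a *: s + s') (ptV t x)) //.
rewrite !rvalD !reg_scaleE; congr (_ * _ + _).
by congr (rval a _); apply: val_inj.
Qed.

Lemma OX_act1 (I : chart n) (s : reg k u I) : tactR (torus1 k n) s = s.
Proof.
apply/regP => x /=; congr (rval s _); apply: val_inj; apply/rowP => i.
by rewrite /= !mxE invr1 mul1r.
Qed.

Lemma OX_actM t t' (I : chart n) (s : reg k u I) :
  tactR (torusM t t') s = tactR t (tactR t' s).
Proof.
apply/regP => x /=; congr (rval s _); apply: val_inj; apply/rowP => i.
by rewrite /= !mxE invfM mulrCA mulrA.
Qed.

Lemma OX_act_res t (I J : chart n) (IJ : cset I \subset cset J) s :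
  tactR t (OX_res IJ s) = OX_res IJ (tactR t s).
Proof. by apply/regP => x /=; congr (rval s _); apply: val_inj. Qed.

Lemma OX_rational (I : chart n) (s : reg k u I) :
  exists w : seq ('rV[int]_n.+1 * reg k u I),
    forall t, tactR t s = \sum_(c <- w) cstA I (mon c.1 (tval t)) *: c.2.
Proof.
have [w [wI sw]] : exists w : seq (k * 'rV[int]_n.+1),
  all (fun c => allowed I c.2) w /\
  forall x, rval s x = \sum_(c <- w) c.1 * mon c.2 (val x).
  by case: s => f /= /asboolP.
have cI c : c \in w ->
  (fun x : pt k u I => c.1 * mon c.2 (val x)) \in @regular k n u I.
  move=> cw; apply/asboolP; exists [:: c]; split; first by rewrite /= (allP wI).
  by move=> x; rewrite big_seq1.
pose F c : reg k u I := if c \in w =P true is ReflectT cw then Reg (cI c cw) else 0.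
exists [seq (- c.2, F c) | c <- w] => t; apply/regP => x.
rewrite rval_sum big_map /= sw; apply: eq_big_seq => c cw.
rewrite mon_ptV mulrCA [RHS](_ : _ = mon (- c.2) (tval t) * rval (F c) x) //.
by rewrite /F; case: eqP.
Qed.

Definition OX : eqcoh := @EqCoh (fun I => reg k u I : lmodType (A k I)) OX_res
  OX_res_linear OX_res_id OX_res_comp OX_res_ker OX_res_im OX_fg
  (fun t I => @tactR k n u I t) OX_semilinear OX_act1 OX_actM OX_act_res
  OX_rational.
End StructureSheaf.

Definition additive_on_exact (K : zmodType) (cls : eqcoh -> K) : Prop :=
  forall E F G, short_exact E F G -> cls F = cls E + cls G.

(* (K, cls) is K_T(P^n): the Grothendieck group of T-equivariant coherent
   sheaves, characterised by its universal property, with the product induced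
   by the tensor product of vector bundles and the R(T)-algebra structure in
   which e^l acts by tensoring with the character l. *)
Record is_KT (K : comAlgType (RT k n)) (cls : eqcoh -> K) : Prop := IsKT {
  KT_additive : additive_on_exact cls;
  KT_universal : forall (B : zmodType) (phi : eqcoh -> B),
    additive_on_exact phi ->
    exists! f : K -> B, {morph f : x y / x + y} /\ forall E, f (cls E) = phi E;
  KT_tensor : forall E F H, vector_bundle E -> vector_bundle F ->
    is_tensor E F H -> cls H = cls E * cls F;
  KT_twist : forall l E, cls (twist l E) = RTchar k l *: cls E }.

Definition xi (K : zmodType) (cls : eqcoh -> K) (u : nat) : K :=
  cls (OX u) - cls (OX u.+1).

End Sheaves.

Section PowerSeries.
Variable B : comNzRingType.

(* The coefficient [P / Q]_p of t^p in the expansion at t = 0 of P / Q, for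
   polynomials P and Q in t (represented by 'X) with Q(0) = 1:
   1 / Q = sum_j (1 - Q)^j, whose terms with j > p do not contribute. *)
Definition ratio_coef (P Q : {poly B}) (p : int) : B :=
  match p with
  | Posz m => (P * \sum_(j < m.+1) (1 - Q) ^+ j)`_m
  | Negz _ => 0
  end.

Lemma ratio_coefP (P Q : {poly B}) (m : nat) : Q`_0 = 1 ->
  \sum_(i < m.+1) Q`_i * ratio_coef P Q (m - i)%N = P`_m.
Proof.
move=> Q0.
have XQ j i : (i < j)%N -> ((1 - Q) ^+ j)`_i = 0.
  elim: j i => // j IHj i ij; rewrite exprS coefM big1 // => l _.
  have [->|l0] := posnP l; first by rewrite coefB coef1 Q0 subrr mul0r.
  by rewrite IHj ?mulr0 //; case: i ij l l0 => [|i] ij [[|l] li] //= _;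
     rewrite subSS (leq_ltn_trans (leq_subr _ _)).
have ext (N i : nat) : (i <= N)%N ->
    ratio_coef P Q i = (P * \sum_(j < N.+1) (1 - Q) ^+ j)`_i.
  move=> iN; rewrite /= !coefM; apply: eq_bigr => a _; congr (_ * _).
  rewrite !coef_sum (big_ord_widen N.+1 (fun j => ((1 - Q) ^+ j)`_(i - a))) //.
  rewrite big_mkcond /=; apply: eq_bigr => j _; case: ltnP => // ij.
  by rewrite XQ // (leq_ltn_trans (leq_subr _ _)).
under eq_bigr => i _ do rewrite (ext m) ?leq_subr //.
rewrite -coefM mulrCA.
have -> : Q * \sum_(j < m.+1) (1 - Q) ^+ j = 1 - (1 - Q) ^+ m.+1.
  by rewrite -{1}[Q](subKr 1) -{1}[1 in RHS](expr1n _ m.+1) [RHS]subrXX;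
     congr (_ * _); apply: eq_bigr => j _; rewrite expr1n mul1r.
rewrite mulrBr mulr1 coefB coefM [X in _ - X]big1 ?subr0 // => i _.
by rewrite XQ ?mulr0 // ltnS leq_subr.
Qed.

End PowerSeries.

(* prod_(i = 1)^j (1 - t e^{eps_i}) as a polynomial in t *)
Definition eps_prod (k : fieldType) n (j : nat) : {poly RT k n} :=
  \prod_(i < n.+1 | (i < j)%N) (1 - (RTchar k (eps i))%:P * 'X).

(* Main.v *)
Require Import Defs.
From HB Require Import structures.
From mathcomp Require Import all_boot all_order all_algebra.
From mathcomp Require Import boolp zify ring.
From mathcomp Require Import reals complex.
(* Again, because [tval] and others are shadowed by MathComp. *)
Import Defs.

(* The sheaf O_{X^u} twisted by O(-1) and by the character -eps_{u+1} is the
   ideal sheaf of X^{u+1} in X^u, via multiplication by x_{u+1}.  Hence, if h is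
   the class of O(-1), [O_{X^u}] = prod_{i <= u} (1 - e^{-eps_i} h), and
   xi^u is, up to the unit (-1)^u e^{-chi_{u+1}}, the class of h N_u(h) with
   N_u(X) = prod_{i <= u} (X - e^{eps_i}).  Since N_{n+1}(h) = 0, the expansion
   of X N_u N_v in the Newton basis N_0, N_1, ... gives the product
   xi^u xi^v; with t = 1/X its coefficients are those of the power series in
   the statement.
   The xi^w are linearly independent over R(T): the dimensions of the weight
   spaces of the sections of E over {x_w <> 0} are finite and additive in E, so
   they define functionals on the Grothendieck group, which are triangular on
   the xi^w. *)

Set Implicit Arguments.
Unset Strict Implicit.
Unset Printing Implicit Defensive.

Import Order.TTheory GRing.Theory Num.Theory.
Local Open Scope ring_scope.

(** * Newton expansion *)

(** [is_KT] describes the product of K only for tensor products of vector bundles, and the sheaves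
    O_{X^u} with 0 < u <= n are not vector bundles. Their classes therefore have to be rewritten by
    additivity in terms of the classes of the O(-j), which can be multiplied. This requires E ->
    E(-1) on all coherent sheaves: it is exact, so the universal property makes it an additive
    operator on K, which turns out to be R(T)-linear and to act as multiplication by h on the span
    of the O(-j). The relation N_{n+1}(h) = 0 expresses that X^{n+1} is empty. The coefficients [p]
    are known only through an expansion, and [is_KT] does not say that the xi^w form a basis;
    comparing [p] with the computed coefficients is what calls for independence. The weight spaces
    are finite although the spaces of sections need not be: the degree 0 monomials on a chart have
    pairwise distinct T-weights, and a coherent sheaf is generated there by finitely many weight
    vectors. *)

Lemma big_fibers (T S : eqType) (V : nmodType) (s : seq T) (f : T -> S) (F : T -> V) :
  \sum_(x <- s) F x = \sum_(y <- undup (map f s)) \sum_(x <- s | f x == y) F x.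
Proof.
rewrite (exchange_big_dep predT) //= big_seq [RHS]big_seq.
apply: eq_bigr => x xs.
rewrite (big_rem (f x)) ?mem_undup ?map_f //= eqxx big_seq_cond big_pred0 ?addr0 // => y.
by rewrite mem_rem_uniq ?undup_uniq // inE [f x == y]eq_sym; case: eqP => //=; rewrite andbF.
Qed.

Section Newton.
Variable B : comNzRingType.

(** The polynomial part of X^d G(1/X), where G is the power series with coefficients [g]. This is
    how the substitution t = 1/X is expressed. *)
Definition rev_sum (d : nat) (g : nat -> B) : {poly B} :=
  \sum_(j < d.+1) g j *: 'X^(d - j).

Lemma rev_sumS d g : rev_sum d.+1 g = 'X * rev_sum d g + (g d.+1)%:P.
Proof.
rewrite /rev_sum big_ord_recr /= subnn expr0 alg_polyC; congr (_ + _).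
rewrite mulr_sumr; apply: eq_bigr => j _.
by rewrite subSn ?exprS ?scalerAr // -ltnS.
Qed.

(** The coefficients of (1 - a t) G(t). *)
Definition mul_lin (a : B) (g : nat -> B) (j : nat) : B :=
  if j is i.+1 then g i.+1 - a * g i else g 0%N.

(** X^{d+1} (1 - a/X) G(1/X) = (X - a) X^d G(1/X). The constant g_{d+1} comes from the first term
    cut off in [rev_sum d g], which the factor X makes polynomial again. *)
Lemma rev_sum_mul_lin d a g :
  rev_sum d.+1 (mul_lin a g) = ('X - a%:P) * rev_sum d g + (g d.+1)%:P.
Proof.
have -> : rev_sum d.+1 (mul_lin a g) = rev_sum d.+1 g - a%:P * rev_sum d g.
  rewrite /rev_sum mulr_sumr big_ord_recl [X in X - _]big_ord_recl -addrA.
  congr (_ + _); rewrite -sumrB; apply: eq_bigr => j _.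
  by rewrite /= scalerBl subSS mul_polyC scalerA.
by rewrite rev_sumS mulrBl addrAC.
Qed.

(** Since Q(0) = 1, the convolution equation of index m determines g_m from the earlier
    coefficients. *)
Lemma ratio_coef_unique (P Q : {poly B}) (g : nat -> B) : Q`_0 = 1 ->
  (forall m : nat, \sum_(i < m.+1) Q`_i * g (m - i)%N = P`_m) ->
  forall m : nat, g m = ratio_coef P Q m.
Proof.
move=> Q0 gP; elim/ltn_ind => m IH.
have := gP m; rewrite -(ratio_coefP P m Q0) !big_ord_recl /= Q0 !mul1r subn0.
rewrite [X in _ + X = _](eq_bigr (fun i : 'I_m => Q`_(lift ord0 i) *
   ratio_coef P Q (m - lift ord0 i)%N)) => [/addIr //|i _].
by congr (_ * _); apply: IH; have := ltn_ord i; rewrite /bump /=; lia.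
Qed.

Lemma coef_mul_lin a (p : {poly B}) j :
  ((1 - a%:P * 'X) * p)`_j = mul_lin a (nth 0 p) j.
Proof.
rewrite mulrBl mul1r coefB -mulrA coefCM coefXM.
by case: j => [|j] //=; rewrite mulr0 subr0.
Qed.

(** P / Q = (1 - a t) * P / (Q (1 - a t)), read off coefficientwise through [ratio_coef_unique]. *)
Lemma ratio_coef_mul_lin (P Q : {poly B}) (a : B) : Q`_0 = 1 ->
  forall m : nat, ratio_coef P Q m =
    mul_lin a (fun j => ratio_coef P (Q * (1 - a%:P * 'X)) (Posz j)) m.
Proof.
move=> Q0 m; set Q' := Q * _; set g := fun j => _.
have Q'0 : Q'`_0 = 1.
  by rewrite /Q' coef0M coefB coef1 coefCM coefX Q0 mulr0 subr0 mulr1.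
apply/esym/ratio_coef_unique => // {}m.
rewrite -(ratio_coefP P m Q'0) -/g.
(* Cutting the series [g] after degree m allows associativity of the polynomial product to be
   used. *)
pose G := \poly_(i < m.+1) g i.
have GE i : (i <= m)%N -> G`_i = g i by move=> im; rewrite coef_poly ltnS im.
transitivity ((Q * ((1 - a%:P * 'X) * G))`_m).
  rewrite coefM; apply: eq_bigr => i _; congr (_ * _).
  rewrite coef_mul_lin; have := leq_subr i m; case: (m - i)%N => [|j] jm /=.
    by rewrite GE.
  by rewrite !GE // ltnW.
rewrite mulrA coefM; apply: eq_bigr => i _.
by rewrite GE ?leq_subr.
Qed.

Variable a : nat -> B.

(** This is t^w N_w(1/t), the reciprocal polynomial of [newton w]. *)
Definition recip (w : nat) : {poly B} := \prod_(i < w) (1 - (a i)%:P * 'X).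
Definition newton (w : nat) : {poly B} := \prod_(i < w) ('X - (a i)%:P).

Lemma recipS w : recip w.+1 = recip w * (1 - (a w)%:P * 'X).
Proof. exact: big_ord_recr. Qed.

Lemma newtonS w : newton w.+1 = newton w * ('X - (a w)%:P).
Proof. exact: big_ord_recr. Qed.

Lemma recip0 w : (recip w)`_0 = 1.
Proof.
elim: w => [|w IH]; first by rewrite /recip big_ord0 coef1.
by rewrite recipS coef0M IH coefB coef1 coefCM coefX mulr0 subr0 mulr1.
Qed.

Lemma size_mul_lin (p : {poly B}) d c :
  (size p <= d)%N -> (size (p * (1 - c%:P * 'X))%R <= d.+1)%N.
Proof.
move=> pd; apply/leq_sizeP => j dj; rewrite mulrC coef_mul_lin.
case: j dj => // j dj /=.
by rewrite !nth_default ?mulr0 ?subrr //; apply: (leq_trans pd); rewrite // ltnW.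
Qed.

Lemma rev_sum_coef_mul_lin (p : {poly B}) d c : (size p <= d.+1)%N ->
  rev_sum d.+1 (nth 0 (p * (1 - c%:P * 'X))) = ('X - c%:P) * rev_sum d (nth 0 p).
Proof.
move=> pd; have := rev_sum_mul_lin d c (nth 0 p).
rewrite [p`_d.+1]nth_default // addr0 => <-.
by apply: eq_bigr => j _; rewrite mulrC coef_mul_lin.
Qed.

(** The size bound belongs to the induction: it kills the extra constant of [rev_sum_mul_lin] at
    each step. *)
Lemma rev_sum_recipM u v :
  (size (recip u * recip v)%R <= (u + v).+1)%N /\
  rev_sum (u + v) (nth 0 (recip u * recip v)) = newton u * newton v.
Proof.
elim: v => [|v [IHs IH]].
  rewrite addn0 /recip /newton !big_ord0 !mulr1.
  elim: u => [|u [IHs IH]].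
    rewrite !big_ord0 size_poly1; split=> //.
    by rewrite /rev_sum big_ord1 coef1 /= expr0 scale1r.
  rewrite !big_ord_recr /= size_mul_lin // rev_sum_coef_mul_lin // IH.
  by split=> //; rewrite mulrC.
rewrite addnS recipS newtonS mulrA size_mul_lin // rev_sum_coef_mul_lin // IH.
by split=> //; rewrite mulrC mulrA.
Qed.

(** Put M = u + v + 1 and let g_w be the series P / [recip w], so that g_w = (1 - a_w t) g_{w+1}.
    The remainder after m terms is N_m times the polynomial part of X^{M-m} g_m(1/X). Splitting off
    one factor X - a_m leaves the coefficient of g_{m+1} of index M - m = u + v - m + 1. *)
Lemma newton_expansion u v m : exists r : {poly B},
  'X * (newton u * newton v) =
  \sum_(w < m) (ratio_coef (recip u * recip v) (recip w.+1)
                  (u%:Z + v%:Z - w%:Z + 1))%:P * newton w + newton m * r.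
Proof.
set P := recip u * recip v; have [Ps PE] := rev_sum_recipM u v.
pose M := (u + v).+1; pose g w j := ratio_coef P (recip w) (Posz j).
have gS w j : g w j = mul_lin (a w) (g w.+1) j.
  rewrite /g recipS.
  by apply: ratio_coef_mul_lin; apply: recip0.
suff E : 'X * (newton u * newton v) =
  \sum_(w < m) (ratio_coef P (recip w.+1)
                  (u%:Z + v%:Z - w%:Z + 1))%:P * newton w +
  newton m * (if (m <= M)%N then rev_sum (M - m) (g m) else 0).
  by eexists; exact: E.
elim: m => [|m IH].
  rewrite big_ord0 add0r /newton big_ord0 mul1r /= subn0 -/(newton u) -/(newton v).
  have gE j : P`_j = g 0%N j.
    rewrite /g /recip big_ord0; apply: ratio_coef_unique; first by rewrite coef1.
    move=> l; rewrite big_ord_recl coef1 mul1r subn0 big1 ?addr0 // => i _.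
    by rewrite coef1 mul0r.
  have -> : rev_sum M (g 0%N) = rev_sum M (nth 0 P) by apply: eq_bigr => j _; rewrite gE.
  (* P has degree at most u + v, so its coefficient of index M vanishes. *)
  by rewrite rev_sumS PE nth_default ?addr0.
rewrite IH [in RHS]big_ord_recr /= -addrA; congr (_ + _).
rewrite newtonS.
have [mM|Mm] := ltnP m M; last first.
  have [mM|mM] := leqP m M; last first.
    (* Past M the index u + v - m + 1 is negative, where [ratio_coef] is 0 by definition. *)
    rewrite !mulr0 addr0 [X in _ = X%:P * _](_ : _ = 0) ?mul0r //.
    by rewrite (_ : u%:Z + v%:Z - m%:Z + 1 = Negz (m - M.+1)) // NegzE /M; lia.
  have {mM Mm} -> : m = M by apply/eqP; rewrite eqn_leq mM.
  rewrite subnn mulr0 addr0 mulrC; congr (_ * _).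
  rewrite /rev_sum big_ord1 subnn expr0 alg_polyC gS /=; congr (_%:P).
  by rewrite /g; congr ratio_coef; rewrite /M; lia.
rewrite (ltnW mM) (_ : (M - m)%N = (M - m.+1).+1); last by rewrite subnSK.
rewrite [rev_sum _ (g m)](_ : _ = rev_sum (M - m.+1).+1 (mul_lin (a m) (g m.+1))); last first.
  by apply: eq_bigr => j _; rewrite gS.
rewrite rev_sum_mul_lin mulrDr mulrA addrC; congr (_ + _).
by rewrite mulrC; congr (_%:P * _); rewrite /g; congr ratio_coef; rewrite /M; lia.
Qed.

End Newton.

(** * Dimensions of subspaces *)

Section Dimension.
Variable k : fieldType.
Implicit Type V : lmodType k.

Definition spanning V (W : V -> Prop) d (b : 'I_d -> V) : Prop :=
  (forall j, W (b j)) /\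
  forall s, W s -> exists c : 'I_d -> k, s = \sum_j c j *: b j.

Definition has_dim V (W : V -> Prop) d : Prop :=
  exists2 b : 'I_d -> V, spanning W b &
    forall c : 'I_d -> k, \sum_j c j *: b j = 0 -> forall j, c j = 0.

Lemma has_dim_leq V (W : V -> Prop) d d' : has_dim W d -> has_dim W d' -> (d <= d')%N.
Proof.
move=> [b [bW _] bfree] [b' [_ b'span] _]; rewrite leqNgt; apply/negP => lt_d'd.
have /choice[c cE] j := b'span _ (bW j).
pose M : 'M[k]_(d, d') := \matrix_(i, j) c i j.
have : kermx M != 0.
  rewrite kermx_eq0 -row_leq_rank -ltnNge.
  exact: leq_ltn_trans (rank_leq_col M) lt_d'd.
case/matrix0Pn => i [j]; apply/negP/negPn/eqP.
apply: (bfree (fun l => kermx M i l)).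
under eq_bigr => l _ do rewrite cE scaler_sumr.
rewrite exchange_big big1 //= => l _.
under eq_bigr => x _ do rewrite scalerA.
rewrite -scaler_suml (_ : \sum_x _ = (kermx M *m M) i l).
  by rewrite mulmx_ker mxE scale0r.
by rewrite mxE; apply: eq_bigr => x _; rewrite [M _ _]mxE.
Qed.

Lemma has_dim_uniq V (W : V -> Prop) d d' : has_dim W d -> has_dim W d' -> d = d'.
Proof. by move=> Wd Wd'; apply/eqP; rewrite eqn_leq !(@has_dim_leq _ W). Qed.

(** A spanning family of minimal length is free: a relation with c_j nonzero would allow b_j to be
    dropped. *)
Lemma spanning_has_dim V (W : V -> Prop) r (b : 'I_r -> V) :
  spanning W b -> exists d, has_dim W d.
Proof.
move=> bW; pose P d := `[< exists b' : 'I_d -> V, spanning W b' >].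
have exP : exists d, P d by exists r; apply/asboolP; exists b.
case: (ex_minnP exP) => d /asboolP[b' [b'W b'span]] dmin.
exists d, b' => // c c0 j; apply/eqP/negPn/negP => cj.
case: d => [|d] in b' b'W b'span dmin c c0 j cj *; first by case: j {cj}.
suff : P d by move/dmin; rewrite ltnn.
apply/asboolP; exists (fun i => b' (lift j i)); split=> // s /b'span[e ->].
have bj : b' j = - \sum_i (c (lift j i) / c j) *: b' (lift j i).
  move: c0; rewrite (bigD1_ord j) //= => /(congr1 ( *:%R (c j)^-1)).
  rewrite scaler0 scalerDr scalerA mulVf // scale1r => /eqP.
  rewrite addr_eq0 => /eqP->; congr (- _); rewrite scaler_sumr.
  by apply: eq_bigr => i _; rewrite scalerA mulrC.
exists (fun i => e (lift j i) - e j * (c (lift j i) / c j)).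
rewrite (bigD1_ord j) //= bj scalerN scaler_sumr -sumrN -big_split /=.
by apply: eq_bigr => i _; rewrite scalerA addrC scalerBl.
Qed.

(** The image of a basis of W1 and lifts to W2 of a basis of W3 together form a basis of W2. *)
Lemma has_dim_exact V1 V2 V3 (W1 : V1 -> Prop) (W2 : V2 -> Prop) (W3 : V3 -> Prop)
    (f : {linear V1 -> V2}) (g : {linear V2 -> V3}) d1 d3 :
  (forall s s', W2 s -> W2 s' -> W2 (s - s')) ->
  (forall (c : k) s, W2 s -> W2 (c *: s)) ->
  injective f -> (forall s, W1 s -> W2 (f s)) -> (forall s, W2 s -> W3 (g s)) ->
  (forall s, g (f s) = 0) ->
  (forall s, W2 s -> g s = 0 -> exists2 s', W1 s' & f s' = s) ->
  (forall s, W3 s -> exists2 s', W2 s' & g s' = s) ->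
  has_dim W1 d1 -> has_dim W3 d3 -> has_dim W2 (d1 + d3).
Proof.
move=> W2B W2Z finj fW gW gf gker gsurj [b1 [b1W b1span] b1free] [b3 [b3W b3span] b3free].
have /choice[b2 b2E] j : exists s, W2 s /\ g s = b3 j.
  by have [s sW sE] := gsurj _ (b3W j); exists s.
pose b i := match split i with inl j => f (b1 j) | inr j => b2 j end.
have bl j : b (lshift d3 j) = f (b1 j).
  by rewrite /b (_ : split _ = inl j) // (unsplitK (inl j)).
have br j : b (rshift d1 j) = b2 j.
  by rewrite /b (_ : split _ = inr j) // (unsplitK (inr j)).
have sumE (c : 'I_(d1 + d3) -> k) : \sum_j c j *: b j =
    f (\sum_j c (lshift d3 j) *: b1 j) + \sum_j c (rshift d1 j) *: b2 j.
  rewrite big_split_ord /= linear_sum; congr (_ + _); apply: eq_bigr => j _.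
    by rewrite bl linearZ.
  by rewrite br.
have gsum (c : 'I_d3 -> k) : g (\sum_j c j *: b2 j) = \sum_j c j *: b3 j.
  by rewrite linear_sum; apply: eq_bigr => j _; rewrite linearZ /= (b2E j).2.
exists b; first split.
- by move=> j; rewrite /b; case: (split j) => i; [apply: fW | apply: (b2E i).1].
- move=> s sW; have [c3 c3E] := b3span _ (gW _ sW).
  pose s' := s - \sum_j c3 j *: b2 j.
  have s'W : W2 s'.
    rewrite /s'; elim: (index_enum _) => [|j l IH]; first by rewrite big_nil subr0.
    rewrite big_cons opprD addrCA addrC; apply: W2B => //.
    by apply: W2Z; apply: (b2E j).1.
  have gs' : g s' = 0 by rewrite raddfB /= gsum -c3E subrr.
  have [s1 /b1span[c1 c1E] s1E] := gker _ s'W gs'.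
  exists (fun i => match split i with inl j => c1 j | inr j => c3 j end).
  rewrite sumE; have -> : s = f s1 + \sum_j c3 j *: b2 j by rewrite s1E subrK.
  congr (f _ + _); first rewrite c1E; apply: eq_bigr => j _.
    by rewrite (_ : split _ = inl j) // (unsplitK (inl j)).
  by rewrite (_ : split _ = inr j) // (unsplitK (inr j)).
- move=> c; rewrite sumE => E.
  have c3 j : c (rshift d1 j) = 0.
    move: j; apply: b3free; rewrite -gsum; move/(congr1 g): E.
    by rewrite raddfD /= gf add0r raddf0.
  have c1 j : c (lshift d3 j) = 0.
    move: j; apply: b1free; apply: finj; rewrite raddf0 -[RHS]E.
    by rewrite [X in _ = _ + X]big1 ?addr0 // => j _; rewrite c3 scale0r.
  by move=> j; rewrite -[j]splitK; case: (split j) => i /=.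
Qed.

Lemma has_dim0 V (W : V -> Prop) d : has_dim W d -> (forall s, W s -> s = 0) -> d = 0%N.
Proof.
case: d => // d [b [bW _] bfree] W0.
suff /eqP : (1 : k) = 0 by rewrite oner_eq0.
apply: (bfree (fun=> 1) _ ord0); rewrite big1 // => j _.
by rewrite (W0 _ (bW j)) scaler0.
Qed.

Lemma has_dim_neq0 V (W : V -> Prop) d s : has_dim W d -> W s -> s != 0 -> d != 0%N.
Proof.
move=> [b [_ bspan] _] /bspan[c ->]; case: d b bspan c => // b _ c.
by rewrite big_ord0 !eqxx.
Qed.

Definition subspace_dim V (W : V -> Prop) : nat :=
  if pselect (exists d, has_dim W d) is left h then projT1 (cid h) else 0%N.

Lemma subspace_dimE V (W : V -> Prop) d : has_dim W d -> subspace_dim W = d.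
Proof.
rewrite /subspace_dim; case: pselect => [h|noW Wd]; last by case: noW; exists d.
by case: cid => d' /= ?; apply: has_dim_uniq.
Qed.

End Dimension.

(** * Weights and characters of T *)

Section Weights.
Variables (k : numFieldType) (n : nat).
Implicit Types (l m : 'rV[int]_n.+1) (t : torus k n).

(* The representative with first entry 0 of a weight modulo (1, ..., 1). *)
Definition wnorm l : 'rV[int]_n.+1 := l - const_mx (l 0 0).

Lemma wnormB l m : wnorm (l - m) = wnorm l - wnorm m.
Proof. by apply/rowP => j; rewrite !mxE; ring. Qed.

Lemma wnormK l : wnorm (wnorm l) = wnorm l.
Proof. by apply/rowP => j; rewrite !mxE; ring. Qed.

Lemma mon_const c t : mon (const_mx c) (tval t) = 1.
Proof.
rewrite /mon; under eq_bigr do rewrite mxE.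
case: c => c.
  by under eq_bigr do rewrite -exprnP; rewrite prodrXl torus_prod expr1n.
under eq_bigr do rewrite NegzE -exprz_inv -exprnP.
by rewrite prodrXl prodfV torus_prod invr1 expr1n.
Qed.

Lemma mon_wnorm l t : mon (wnorm l) (tval t) = mon l (tval t).
Proof.
have {2}-> : l = wnorm l + const_mx (l 0 0) by rewrite subrK.
by rewrite mon_torusD mon_const mulr1.
Qed.

Lemma mon_neq0 l t : mon l (tval t) != 0.
Proof. by apply/prodf_neq0 => i _; rewrite expfz_neq0 ?torus_neq0. Qed.

Lemma mon_tN l t : mon (- l) (tval t) = (mon l (tval t))^-1.
Proof.
apply: (mulfI (mon_neq0 l t)).
by rewrite -mon_torusD subrr mon0 mulfV ?mon_neq0.
Qed.

(** Characteristic 0 makes 2 a unit of infinite order, which is what separates characters below. *)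
Lemma two_expz_neq1 (d : int) : d != 0 -> (2 : k) ^ d != 1.
Proof.
have pow d' : (2 : k) ^+ d'.+1 != 1.
  by rewrite gt_eqF // exprn_egt1 // ltr1n.
case: d => [[|d]|d] // _; first exact: pow.
by rewrite NegzE -exprz_inv -exprnP exprVn invr_eq1 pow.
Qed.

Lemma char_neq l m : wnorm l != wnorm m -> exists t, mon l (tval t) != mon m (tval t).
Proof.
move=> lm; have : wnorm (l - m) != 0 by rewrite wnormB subr_eq0.
case/matrix0Pn => i [j]; rewrite (ord1 i) !mxE => d0.
have j0 : j != 0 by apply: contraNneq d0 => ->; apply/eqP; ring.
(* The entries 2 at j and 1/2 at 0 have product 1, and l takes the value 2^(l_j - l_0) here: the
   exponent is the entry j of [wnorm l]. *)
pose x : 'rV[k]_n.+1 := \row_i (if i == j then 2 else if i == 0 then 2^-1 else 1).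
have prodx (e : 'rV[int]_n.+1) : mon e x = 2 ^ (e 0 j - e 0 0).
  rewrite /mon (bigD1 j) //= (bigD1 0) /=; last by rewrite eq_sym.
  rewrite big1 => [|a /andP[aj a0]].
    rewrite !mxE eqxx [0 == j]eq_sym (negPf j0) mulr1 eqxx.
    by rewrite exprz_inv -expfzDr ?pnatr_eq0.
  by rewrite !mxE (negPf aj) (negPf a0) exp1rz.
have x1 : \prod_i x 0 i == 1.
  (* The product of the entries is the monomial with all exponents 1, hence 2^(1 - 1). *)
  have P1 := prodx (const_mx 1); rewrite !mxE subrr expr0z in P1.
  apply/eqP; rewrite -[RHS]P1; apply: eq_bigr => a _.
  by rewrite [const_mx _ _ _]mxE expr1z.
exists (Torus x1); rewrite /= !prodx -subr_eq0.
have -> : l 0 j - l 0 0 = (m 0 j - m 0 0) + ((l 0 j - m 0 j) - (l 0 0 - m 0 0)) by ring.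
rewrite expfzDr ?pnatr_eq0 // -{2}[2 ^ (m 0 j - m 0 0)]mulr1 -mulrBr mulf_neq0 //.
  by rewrite expfz_neq0 ?pnatr_eq0.
by rewrite subr_eq0 two_expz_neq1.
Qed.

Variable V : lmodType k.

(** Artin's argument with vector coefficients: multiplying the relation at t by m(t') and comparing
    with the relation at t't eliminates m, and t' is chosen with l(t') different from m(t'). *)
Lemma char_independent (ls : seq 'rV[int]_n.+1) (v : 'rV[int]_n.+1 -> V) :
  uniq (map wnorm ls) ->
  (forall t, \sum_(l <- ls) mon l (tval t) *: v l = 0) ->
  forall l, l \in ls -> v l = 0.
Proof.
elim: ls v => [|m ls IH] //= v /andP[mls lsu] sum0.
have v0 l : l \in ls -> v l = 0.
  move=> lls; have : wnorm l != wnorm m.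
    by apply: contraNneq mls => <-; apply: map_f.
  case/char_neq => t' ne.
  suff /eqP : (mon l (tval t') - mon m (tval t')) *: v l = 0.
    by rewrite scaler_eq0 subr_eq0 (negPf ne) => /eqP.
  move: {ne} l lls; apply: IH => // t.
  have := sum0 (torusM t' t); rewrite big_cons mon_torusM => E1.
  have := congr1 ( *:%R (mon m (tval t'))) (sum0 t); rewrite big_cons scalerDr scaler0.
  rewrite scalerA -[RHS]E1 => /addrI E2.
  under eq_bigr do rewrite scalerA mulrC mulrBl scalerBl.
  rewrite sumrB; apply/eqP; rewrite subr_eq0; apply/eqP.
  move: E2; rewrite scaler_sumr => E2.
  transitivity (\sum_(l <- ls) mon l (tval (torusM t' t)) *: v l).
    by apply: eq_bigr => l _; rewrite mon_torusM.
  by rewrite -E2; apply: eq_bigr => l _; rewrite scalerA.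
move=> l; rewrite inE => /predU1P[->|/v0 //].
have := sum0 (torus1 k n); rewrite big_cons mon_one scale1r big_seq big1 ?addr0 // => i iw.
by rewrite v0 ?scaler0.
Qed.

(** When [w] expands t . s in characters of t, this is the projection of s to the weight space of
    [l]. *)
Definition wcomp (w : seq ('rV[int]_n.+1 * V)) l : V :=
  \sum_(c <- w | wnorm c.1 == wnorm l) c.2.

Definition weights (w : seq ('rV[int]_n.+1 * V)) := undup [seq wnorm c.1 | c <- w].

Lemma weights_uniq w : uniq (map wnorm (weights w)).
Proof.
rewrite map_inj_in_uniq ?undup_uniq // => l m.
rewrite !mem_undup => /mapP[c _ ->] /mapP[d _ ->].
by rewrite !wnormK.
Qed.

Lemma sum_weights w t :
  \sum_(c <- w) mon c.1 (tval t) *: c.2 =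
  \sum_(l <- weights w) mon l (tval t) *: wcomp w l.
Proof.
rewrite (big_fibers _ (fun c => wnorm c.1)) big_seq [RHS]big_seq.
apply: eq_bigr => l; rewrite mem_undup => /mapP[d _ ->].
rewrite /wcomp scaler_sumr wnormK; apply: eq_bigr => c /eqP E.
by rewrite -[mon c.1 _]mon_wnorm E.
Qed.

Lemma wcomp_eq0 w : (forall t, \sum_(c <- w) mon c.1 (tval t) *: c.2 = 0) ->
  forall l, wcomp w l = 0.
Proof.
move=> w0 l; have [lw|lw] := boolP (wnorm l \in weights w).
  have -> : wcomp w l = wcomp w (wnorm l) by rewrite /wcomp wnormK.
  apply: char_independent lw; first exact: weights_uniq.
  by move=> t; rewrite -sum_weights.
rewrite /wcomp big_seq_cond big_pred0 // => c; apply/negP => /andP[cw /eqP E].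
by move: lw; rewrite mem_undup -E (map_f (fun c => wnorm c.1)).
Qed.

Lemma wcomp_unique w w' :
  (forall t, \sum_(c <- w) mon c.1 (tval t) *: c.2 =
             \sum_(c <- w') mon c.1 (tval t) *: c.2) ->
  forall l, wcomp w l = wcomp w' l.
Proof.
move=> E l.
have := @wcomp_eq0 (w ++ [seq (c.1, - c.2) | c <- w']) _ l.
rewrite /wcomp big_cat big_map /= sumrN => W.
apply/eqP; rewrite -subr_eq0; apply/eqP/W => t.
rewrite big_cat big_map /= E -big_split big1 //= => c _.
by rewrite scalerN subrr.
Qed.

End Weights.

(** * Rational representations of T *)

Section RationalModules.
Variables (k : numFieldType) (n : nat).

Record rational_action (V : lmodType k) (rho : torus k n -> V -> V) : Prop :=
  RationalAction {
    rho_linear : forall t (a : k) s s', rho t (a *: s + s') = a *: rho t s + rho t s';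
    rho1 : forall s, rho (torus1 k n) s = s;
    rhoM : forall t t' s, rho (torusM t t') s = rho t (rho t' s);
    rho_rational : forall s, exists w : seq ('rV[int]_n.+1 * V),
      forall t, rho t s = \sum_(c <- w) mon c.1 (tval t) *: c.2 }.

Definition weight_space (V : lmodType k) (rho : torus k n -> V -> V)
    (m : 'rV[int]_n.+1) (s : V) : Prop :=
  forall t, rho t s = mon m (tval t) *: s.

Section OneModule.
Variables (V : lmodType k) (rho : torus k n -> V -> V).
Hypothesis rhoP : rational_action rho.

Lemma rhoD t s s' : rho t (s + s') = rho t s + rho t s'.
Proof. by rewrite -[s]scale1r (rho_linear rhoP) !scale1r. Qed.

Lemma rho0 t : rho t 0 = 0.
Proof. by apply: (@addrI _ (rho t 0)); rewrite -rhoD !addr0. Qed.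

Lemma rhoZ t a s : rho t (a *: s) = a *: rho t s.
Proof. by rewrite -[a *: s]addr0 (rho_linear rhoP) rho0 addr0. Qed.

Lemma rho_sum t (I : Type) (r : seq I) (P : pred I) (F : I -> V) :
  rho t (\sum_(i <- r | P i) F i) = \sum_(i <- r | P i) rho t (F i).
Proof. exact: (big_morph _ (rhoD t) (rho0 t)). Qed.

Lemma weight_spaceB m s s' : weight_space rho m s -> weight_space rho m s' ->
  weight_space rho m (s - s').
Proof.
move=> sm s'm t.
by rewrite rhoD -scaleN1r rhoZ sm s'm scalerDr !scaleN1r scalerN.
Qed.

Lemma weight_spaceZ m a s : weight_space rho m s -> weight_space rho m (a *: s).
Proof. by move=> sm t; rewrite rhoZ sm !scalerA mulrC. Qed.

(** The function t -> t' . (t . s) has two expansions: apply t' to each vector, or expand (t't) . s.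
    Independence of characters identifies their components. *)
Lemma weight_space_wcomp s w : (forall t, rho t s = \sum_(c <- w) mon c.1 (tval t) *: c.2) ->
  forall m, weight_space rho m (wcomp w m).
Proof.
move=> sw m t'.
have := @wcomp_unique _ _ _ [seq (c.1, rho t' c.2) | c <- w]
  [seq (c.1, mon c.1 (tval t') *: c.2) | c <- w] _ m.
rewrite /wcomp !big_map /= rho_sum => ->.
  rewrite scaler_sumr; apply: eq_bigr => c /eqP E.
  by rewrite -[mon c.1 _]mon_wnorm E mon_wnorm.
move=> t; rewrite !big_map /=.
transitivity (rho t' (rho t s)).
  by rewrite sw rho_sum; apply: eq_bigr => c _; rewrite rhoZ.
rewrite -(rhoM rhoP) sw; apply: eq_bigr => c _.
by rewrite mon_torusM mulrC scalerA.
Qed.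

Lemma weight_decomposition s : exists w : seq ('rV[int]_n.+1 * V),
  (forall c, c \in w -> weight_space rho c.1 c.2) /\ s = \sum_(c <- w) c.2.
Proof.
have [w sw] := rho_rational rhoP s.
exists [seq (l, wcomp w l) | l <- weights w]; split.
  by move=> _ /mapP[l _ ->] /=; apply: weight_space_wcomp sw _.
rewrite big_map /= -{1}[s](rho1 rhoP) sw sum_weights.
by apply: eq_bigr => l _; rewrite mon_one scale1r.
Qed.

Lemma weight_space_sum m s (w : seq ('rV[int]_n.+1 * V)) :
  weight_space rho m s -> (forall c, c \in w -> weight_space rho c.1 c.2) ->
  s = \sum_(c <- w) c.2 -> s = wcomp w m.
Proof.
move=> sm ww sE.
have := @wcomp_unique _ _ _ [:: (m, s)] w _ m.
rewrite {1}/wcomp big_cons big_nil /= eqxx addr0 => -> // t.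
rewrite big_cons big_nil /= addr0 -sm [in LHS]sE rho_sum.
by apply: eq_big_seq => c cw; rewrite (ww c).
Qed.

Lemma weight_space_wnorm m m' s : wnorm m = wnorm m' ->
  weight_space rho m s -> weight_space rho m' s.
Proof. by move=> mm sm t; rewrite sm -[mon m _]mon_wnorm mm mon_wnorm. Qed.

End OneModule.

(** Weight spaces depend exactly on the module: a preimage of a vector of weight m can be replaced
    by its component of weight m, which has the same image. *)
Lemma weight_dim_exact (V1 V2 V3 : lmodType k) (r1 : torus k n -> V1 -> V1)
    (r2 : torus k n -> V2 -> V2) (r3 : torus k n -> V3 -> V3)
    (f : {linear V1 -> V2}) (g : {linear V2 -> V3}) m d1 d3 :
  rational_action r2 -> rational_action r3 ->
  (forall t s, f (r1 t s) = r2 t (f s)) -> (forall t s, g (r2 t s) = r3 t (g s)) ->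
  injective f -> (forall s, g s = 0 <-> exists s', f s' = s) ->
  (forall s, exists s', g s' = s) ->
  has_dim (weight_space r1 m) d1 -> has_dim (weight_space r3 m) d3 ->
  has_dim (weight_space r2 m) (d1 + d3).
Proof.
move=> r2P r3P fr gr finj fg gsurj; apply: (has_dim_exact (f := f) (g := g)) => //.
- by move=> s s'; apply: weight_spaceB.
- by move=> c s; apply: weight_spaceZ.
- by move=> s sm t; rewrite -fr sm linearZ.
- by move=> s sm t; rewrite -gr sm linearZ.
- by move=> s; apply/fg; exists s.
- move=> s sm /fg[s' E]; exists s' => // t; apply: finj.
  by rewrite fr E sm linearZ /= E.
- move=> s sm; have [s' E] := gsurj s.
  have [w [ww s'E]] := weight_decomposition r2P s'.
  have wm : weight_space r2 m (wcomp w m).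
    rewrite /wcomp; elim: w ww {s'E} => [|c w IH] ww.
      by rewrite big_nil => t; rewrite rho0 // scaler0.
    rewrite big_cons; have {}IH := IH (fun d dw => ww d (@mem_behead _ (c :: w) d dw)).
    case: eqP => // cm; have cw : weight_space r2 m c.2.
      by apply: weight_space_wnorm cm (ww _ _); rewrite inE eqxx.
    by move=> t; rewrite rhoD // cw IH scalerDr.
  exists (wcomp w m) => //.
  rewrite (@weight_space_sum _ _ r3P m s [seq (c.1, g c.2) | c <- w]) //.
  + by rewrite /wcomp big_map linear_sum.
  + by move=> _ /mapP[c cw ->] t /=; rewrite -gr (ww c) // linearZ.
  + by rewrite big_map -E s'E linear_sum.
Qed.

End RationalModules.

(** * Weight spaces of equivariant sheaves *)

Section Functions.
Variables (k : fieldType) (n : nat).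
Implicit Types (I J : chart n) (m : 'rV[int]_n.+1).

Definition xmon I m : A k I :=
  if allowed I m =P true is ReflectT mI then Reg (monA_subproof k 0 mI) else 0.

Lemma xmonE I m (x : pt k 0 I) : allowed I m -> rval (xmon I m) x = mon m (val x).
Proof. by rewrite /xmon; case: eqP => // ? /[swap]. Qed.

Lemma xmonD I l m : allowed I l -> allowed I m ->
  xmon I l * xmon I m = xmon I (l + m).
Proof.
move=> lI mI; apply/regP => x.
by rewrite rvalM !xmonE ?allowedD // (monD _ lI mI).
Qed.

Lemma xmon0 I : xmon I 0 = 1.
Proof. by apply/regP => x; rewrite xmonE ?allowed0 // mon0. Qed.

Lemma restrA_xmon I J (IJ : cset I \subset cset J) m : allowed I m ->
  restrA IJ (xmon I m) = xmon J m.
Proof.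
by move=> mI; apply/regP => x; rewrite xmonE ?(allowedS IJ) //= xmonE.
Qed.

Lemma tactR_xmon t I m : allowed I m ->
  tactR t (xmon I m) = cstA I (mon (- m) (tval t)) * xmon I m.
Proof.
by move=> mI; apply/regP => x; rewrite rvalM /= !xmonE // mon_ptV.
Qed.

Lemma regular_sum u I (f : reg k u I) : exists s : seq (k * 'rV[int]_n.+1),
  all (fun c => allowed I c.2) s /\
  forall x, rval f x = \sum_(c <- s) c.1 * mon c.2 (val x).
Proof. by case: f => f /= /asboolP. Qed.

Lemma xmon_sum I (a : A k I) : exists2 s : seq (k * 'rV[int]_n.+1),
  all (fun c => allowed I c.2) s & a = \sum_(c <- s) cstA I c.1 * xmon I c.2.
Proof.
have [s [sI sa]] := regular_sum a; exists s => //; apply/regP => x.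
rewrite sa rval_sum; apply: eq_big_seq => c /(allP sI) cI.
by rewrite rvalM xmonE.
Qed.

End Functions.

Section WeightSpaces.
Variables (k : numFieldType) (n : nat).
Implicit Types (E : eqcoh k n) (I : chart n) (m : 'rV[int]_n.+1).

(* An alias of [sec E I], which carries the k-vector space structure. *)
Definition ksec E I : Type := sec E I.
HB.instance Definition _ E I := GRing.Zmodule.copy (ksec E I) (sec E I).

Definition kscale E I (c : k) (s : ksec E I) : ksec E I := cstA I c *: (s : sec E I).

Lemma kscaleA E I (a b : k) (s : ksec E I) : kscale a (kscale b s) = kscale (a * b) s.
Proof. by rewrite /kscale scalerA cstAM. Qed.
Lemma cstA1 I : cstA I (1 : k) = 1.
Proof. exact/regP. Qed.
Lemma kscale1 E I : left_id 1 (@kscale E I).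
Proof. by move=> s; rewrite /kscale cstA1 scale1r. Qed.
Lemma kscaleDr E I : right_distributive (@kscale E I) +%R.
Proof. by move=> a s s'; rewrite /kscale scalerDr. Qed.
Lemma kscaleDl E I (s : ksec E I) : {morph (fun a => kscale a s) : a b / a + b}.
Proof. by move=> a b; rewrite /kscale -scalerDl; congr (_ *: _); apply/regP. Qed.
HB.instance Definition _ E I := GRing.Zmodule_isLmodule.Build k (ksec E I)
  (@kscaleA E I) (@kscale1 E I) (@kscaleDr E I) (@kscaleDl E I).

Lemma ksec_scaleE E I (c : k) (s : ksec E I) : c *: s = cstA I c *: (s : sec E I).
Proof. by []. Qed.

Definition kact E I (t : torus k n) (s : ksec E I) : ksec E I := act t s.

Lemma kact_rational E I : rational_action (@kact E I).
Proof.
split=> [t a s s'|s|t t' s|s].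
- by rewrite /kact act_semilinear tactR_cst.
- exact: act1.
- exact: actM.
- exact: act_rational.
Qed.

(** The weight components of a finite set of module generators generate as well, and functions are
    combinations of monomials. *)
Lemma section_sum E I : exists gens : seq ('rV[int]_n.+1 * ksec E I),
  (forall c, c \in gens -> weight_space (@kact E I) c.1 c.2) /\
  forall s : ksec E I, exists L : seq (k * 'rV[int]_n.+1 * ('rV[int]_n.+1 * ksec E I)),
    (forall q, q \in L -> allowed I q.1.2 /\ q.2 \in gens) /\
    s = \sum_(q <- L) q.1.1 *: (xmon k I q.1.2 *: (q.2.2 : sec E I) : ksec E I).
Proof.
have [r [b bE]] := sec_fg E I.
have /choice[w wE] j := weight_decomposition (kact_rational E I) (b j).
pose gens := flatten [seq w j | j : 'I_r].
have gensP j c : c \in w j -> c \in gens.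
  by move=> cw; apply/flatten_mapP; exists j; rewrite ?mem_enum.
exists gens; split=> [c /flatten_mapP[j _]|s]; first exact: (wE j).1.
pose P (s : ksec E I) :=
  exists L : seq (k * 'rV[int]_n.+1 * ('rV[int]_n.+1 * ksec E I)),
    (forall q, q \in L -> allowed I q.1.2 /\ q.2 \in gens) /\
    s = \sum_(q <- L) q.1.1 *: (xmon k I q.1.2 *: (q.2.2 : sec E I) : ksec E I).
have P0 : P 0 by exists [::]; rewrite big_nil.
have PD s1 s2 : P s1 -> P s2 -> P (s1 + s2).
  move=> [L1 [L1P ->]] [L2 [L2P ->]]; exists (L1 ++ L2); rewrite big_cat; split=> // q.
  by rewrite mem_cat => /orP[/L1P|/L2P].
have [a ->] := bE s; rewrite -/(P _).
apply: (big_ind P) => // j _.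
have -> : a j *: b j = \sum_(c <- w j) (a j *: (c.2 : sec E I) : ksec E I).
  by rewrite {1}(wE j).2; apply: scaler_sumr.
rewrite big_seq; apply: (big_ind P) => // c cw.
have [l lI ->] := xmon_sum (a j).
exists [seq (q, c) | q <- l]; split.
  by move=> _ /mapP[q ql ->] /=; split; [apply: (allP lI) | apply: gensP cw].
rewrite big_map scaler_suml; apply: eq_bigr => q _.
by rewrite ksec_scaleE scalerA.
Qed.

(** The two exponents differ by a multiple of (1, ..., 1), and such a multiple of degree 0 is
    zero. *)
Lemma wnorm_inj_deg0 (l m m' : 'rV[int]_n.+1) : \sum_j m 0 j = 0 -> \sum_j m' 0 j = 0 ->
  wnorm (l - m) = wnorm (l - m') -> m = m'.
Proof.
move=> m0 m'0 /rowP E.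
have d j : m 0 j - m' 0 j = m 0 0 - m' 0 0.
  have := E j; rewrite !mxE => Ej.
  apply/eqP; rewrite -subr_eq0; apply/eqP.
  transitivity ((l 0 j - m' 0 j - (l 0 0 - m' 0 0)) - (l 0 j - m 0 j - (l 0 0 - m 0 0))).
    ring.
  by rewrite Ej subrr.
have : \sum_j (m 0 j - m' 0 j) = 0 by rewrite sumrB m0 m'0 subrr.
under eq_bigr do rewrite d.
rewrite sumr_const card_ord => /eqP; rewrite mulrn_eq0 /= => /eqP d0.
by apply/rowP => j; apply/eqP; rewrite -subr_eq0 d d0.
Qed.

(* A degree 0 monomial is determined by its T-weight, so each weight generator
   contributes at most one vector to the weight space. *)
Lemma weight_space_has_dim E I m : exists d, has_dim (weight_space (@kact E I) m) d.
Proof.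
have [gens [gensP span]] := section_sum E I.
pose good (l mu : 'rV[int]_n.+1) := allowed I mu /\ wnorm (l - mu) = wnorm m.
pose v (c : 'rV[int]_n.+1 * ksec E I) : ksec E I :=
  if pselect (exists mu, good c.1 mu) is left h
  then xmon k I (projT1 (cid h)) *: (c.2 : sec E I) else 0.
have xmon_weight mu c : allowed I mu -> c \in gens ->
    weight_space (@kact E I) (c.1 - mu) (xmon k I mu *: (c.2 : sec E I)).
  move=> muI cg t; have := gensP c cg t; rewrite /kact !ksec_scaleE => cE.
  rewrite actZ cE tactR_xmon //  !scalerA mon_torusD -cstAM.
  apply: (congr1 (fun a => a *: (c.2 : sec E I))).
  by rewrite mulrAC [cstA I (mon c.1 _) * _]mulrC.
have vE mu c : good c.1 mu -> v c = xmon k I mu *: (c.2 : sec E I).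
  move=> g; rewrite /v; case: pselect => [h|[]]; last by exists mu.
  case: cid => mu' /= [mu'I mu'm]; case: g => muI mum; congr (xmon k I _ *: _).
  have /andP[/eqP s0 _] := muI; have /andP[/eqP s0' _] := mu'I.
  by apply: (@wnorm_inj_deg0 c.1) => //; rewrite mu'm.
pose b (j : 'I_(size gens)) := v (nth (0, 0) gens j).
apply: (@spanning_has_dim _ _ _ _ b); split=> [j|s sm].
  rewrite /b; set c := nth _ _ _; have cg : c \in gens by apply: mem_nth.
  have [[mu g]|no] := pselect (exists mu, good c.1 mu).
    rewrite (vE mu) //; case: g => muI mum.
    by apply: weight_space_wnorm mum _; apply: xmon_weight.
  rewrite /v; case: pselect => // _ t.
  by rewrite scaler0 (rho0 (kact_rational E I)).
have [L [LP sE]] := span s.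
rewrite (@weight_space_sum _ _ _ _ (kact_rational E I) m s
  [seq (q.2.1 - q.1.2, q.1.1 *: (xmon k I q.1.2 *: (q.2.2 : sec E I) : ksec E I)) | q <- L]) //.
- pose P (s : ksec E I) := exists c : 'I_(size gens) -> k, s = \sum_j c j *: b j.
  rewrite -/(P _) /wcomp big_map big_seq_cond.
  apply: (big_ind P) => [|_ _ [c1 ->] [c2 ->]|q /andP[/= /LP[qI qg] /eqP qm]].
  + by exists (fun=> 0); rewrite big1 // => j _; rewrite scale0r.
  + exists (fun j => c1 j + c2 j); rewrite -big_split /=.
    by apply: eq_bigr => j _; rewrite scalerDl.
  + have qi : (index q.2 gens < size gens)%N by rewrite index_mem.
    exists (fun j => if j == Ordinal qi then q.1.1 else 0).
    rewrite (bigD1 (Ordinal qi)) //= eqxx big1 ?addr0 => [|j /negPf->]; last exact: scale0r.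
    by rewrite /b /= nth_index // (vE q.1.2).
- move=> _ /mapP[q /LP[qI qg] ->] /=.
  by apply: weight_spaceZ (kact_rational E I) _ _ _ _; apply: xmon_weight.
- by rewrite big_map.
Qed.

(** The multiplicity of the weight [m] in E(U_I), taken in [int] because [KT_universal] expects
    values in a group. *)
Definition hdim E I m : int := (subspace_dim (weight_space (@kact E I) m))%:Z.

Lemma hdim_additive I m : additive_on_exact (fun E => hdim E I m).
Proof.
move=> E F G [f [g [[fl _ fa] [gl _ ga] /(_ I)[finj fg gsurj]]]].
have [d1 E1] := weight_space_has_dim E I m.
have [d3 E3] := weight_space_has_dim G I m.
have flk : linear (f I : ksec E I -> ksec F I) by move=> c s s'; apply: fl.
have glk : linear (g I : ksec F I -> ksec G I) by move=> c s s'; apply: gl.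
pose fL := GRing.isLinear.Build _ _ _ _ _ flk.
pose gL := GRing.isLinear.Build _ _ _ _ _ glk.
pose f' : {linear ksec E I -> ksec F I} := HB.pack (f I : ksec E I -> ksec F I) fL.
pose g' : {linear ksec F I -> ksec G I} := HB.pack (g I : ksec F I -> ksec G I) gL.
have E2 := @weight_dim_exact _ _ _ _ _ _ _ _ f' g' m d1 d3 (kact_rational F I)
  (kact_rational G I) (fun t => fa t I) (fun t => ga t I) finj fg gsurj E1 E3.
by rewrite /hdim (subspace_dimE E1) (subspace_dimE E2) (subspace_dimE E3) PoszD.
Qed.

Lemma hdim_twist l E I m : hdim (twist l E) I m = hdim E I (m - l).
Proof.
rewrite /hdim; congr (subspace_dim _)%:Z; apply/funext => s; apply/propext.
split=> sm t.
  have := sm t; rewrite !ksec_scaleE /kact /= /twist_act.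
  move=> /(congr1 ( *:%R (cstA I (mon l (tval t))^-1))).
  rewrite !scalerA !cstAM mulVf ?mon_neq0 // cstA1 scale1r => ->.
  by rewrite mon_torusD mon_tN mulrC.
have := sm t; rewrite !ksec_scaleE /kact /= /twist_act => ->.
by rewrite scalerA cstAM -mon_torusD addrC subrK.
Qed.

Lemma hdim_wnorm E I m m' : wnorm m = wnorm m' -> hdim E I m = hdim E I m'.
Proof.
move=> mm; rewrite /hdim; congr (subspace_dim _)%:Z; apply/funext => s; apply/propext.
by split; apply: weight_space_wnorm.
Qed.

Lemma hdim_eq0 E I m :
  (forall s, weight_space (@kact E I) m s -> s = 0) -> hdim E I m = 0.
Proof.
move=> s0; have [d dE] := weight_space_has_dim E I m.
by rewrite /hdim (subspace_dimE dE) (has_dim0 dE s0).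
Qed.

Lemma hdim_neq0 E I m (s : ksec E I) :
  weight_space (@kact E I) m s -> s != 0 -> hdim E I m != 0.
Proof.
move=> sm s0; have [d dE] := weight_space_has_dim E I m.
by rewrite /hdim (subspace_dimE dE) eqz_nat (has_dim_neq0 dE sm).
Qed.

End WeightSpaces.

(** * Linear independence of the xi^w *)

Section StructureSheafWeights.
Variables (k : numFieldType) (n : nat).
Implicit Types (w : 'I_n.+1) (m l : 'rV[int]_n.+1).

Lemma chart1_subproof w : [set w]%SET != finset.set0.
Proof. by apply/set0Pn; exists w; rewrite in_set1. Qed.
Definition chart1 w : chart n := Chart (chart1_subproof w).

(** X^u does not meet the chart where coordinate w is nonzero, so every function on the intersection
    is zero. *)
Lemma hdim_OX_lt u w m : (w < u)%N -> hdim (OX k n u) (chart1 w) m = 0.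
Proof.
move=> wu; apply: hdim_eq0 => s _; apply/regP => x.
have /andP[/forallP/(_ w)/implyP/(_ wu) xw /forallP/(_ w)/implyP] := valP x.
by rewrite in_set1 eqxx xw => /(_ isT).
Qed.

(* On chart1 w the functions x_j / x_w have the weights eps_w - eps_j, on which
   this form is negative. *)
Definition height w l : int := \sum_j l 0 j - l 0 w *+ n.+1.

Lemma height_wnorm w l : height w (wnorm l) = height w l.
Proof.
rewrite /height; under eq_bigr do rewrite !mxE.
rewrite sumrB sumr_const card_ord !mxE mulrnBl; ring.
Qed.

Lemma heightB w l m : height w (l - m) = height w l - height w m.
Proof.
rewrite /height; under eq_bigr do rewrite !mxE.
by rewrite sumrB !mxE mulrnBl; ring.
Qed.

Lemma wnorm0 : wnorm (0 : 'rV[int]_n.+1) = 0.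
Proof. by apply/rowP => j; rewrite !mxE subrr. Qed.

(** The height of -mu is (n+1) mu_w. If it is nonnegative, all entries of mu are, and their sum is
    0. *)
Lemma height_allowed w mu : allowed (chart1 w) mu -> 0 <= height w (- mu) -> mu = 0.
Proof.
move=> /andP[/eqP mu0 /forallP mup].
rewrite /height; under eq_bigr do rewrite !mxE.
rewrite sumrN mu0 oppr0 sub0r !mxE mulNrn opprK pmulrn_lge0 // => muw.
have mu_ge0 j : 0 <= mu 0 j.
  have [->//|jw] := eqVneq j w.
  by apply: (implyP (mup j)); rewrite in_set1.
apply/rowP => j; rewrite mxE.
have /eqP := mu0; rewrite psumr_eq0 => [/allP/(_ j)|i _]; last exact: mu_ge0.
by rewrite mem_index_enum => /(_ isT)/eqP.
Qed.

Lemma OX_act_one u I t : @act k n (OX k n u) t I (1 : reg k u I) = (1 : reg k u I).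
Proof. exact/regP. Qed.

Lemma hdim_OX_height w m : 0 <= height w m -> wnorm m != 0 ->
  hdim (OX k n w) (chart1 w) m = 0.
Proof.
move=> hm m0; apply: hdim_eq0 => s sm; set I := chart1 w.
have [L [LI sL]] := regular_sum s.
have IP := kact_rational (OX k n w) I.
pose F (c : k * 'rV[int]_n.+1) : ksec (OX k n w) I :=
  c.1 *: (xmon k I c.2 *: (1 : reg k w I) : ksec (OX k n w) I).
rewrite (@weight_space_sum _ _ _ _ IP m s [seq (- c.2, F c) | c <- L]) //.
- rewrite /wcomp big_map big_seq_cond big_pred0 // => c.
  apply/negP => /andP[/(allP LI) cI /= /eqP cm].
  have c0 : c.2 = 0.
    apply: (height_allowed cI).
    by rewrite -height_wnorm cm height_wnorm.
  by move: m0; rewrite -cm c0 oppr0 wnorm0 eqxx.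
- move=> _ /mapP[c /(allP LI) cI ->] /=; apply: weight_spaceZ => // t.
  rewrite /kact actZ OX_act_one tactR_xmon // ksec_scaleE.
  by rewrite scalerA.
- rewrite big_map; apply/regP => x; rewrite sL /=.
  rewrite (rval_sum L F); apply: eq_big_seq => c /(allP LI) cI.
  by rewrite /F ksec_scaleE !reg_scaleE xmonE //= mulr1.
Qed.

(** The constant function 1 has weight 0, and it is nonzero because the T-fixed point with only
    coordinate w nonzero lies on X^w. *)
Lemma hdim_OX_0 w : hdim (OX k n w) (chart1 w) 0 != 0.
Proof.
apply: (@hdim_neq0 k n (OX k n w) (chart1 w) 0 (1 : reg k w (chart1 w))) => [t|].
  by rewrite /kact OX_act_one mon0 scale1r.
have xw : in_chart w (chart1 w) (delta_mx 0 w : 'rV[k]_n.+1).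
  apply/andP; split; apply/forallP => j; apply/implyP; rewrite mxE eqxx /=.
    by have [->|] := eqVneq j w; rewrite ?ltnn ?eqxx.
  by rewrite in_set1 => /eqP->; rewrite eqxx oner_neq0.
apply/eqP => /(congr1 (fun f : reg k w (chart1 w) => rval f (Sub _ xw))).
by rewrite rval1 rval0 => /eqP; rewrite oner_eq0.
Qed.

End StructureSheafWeights.

Lemma seq_argmax (T : eqType) (h : T -> int) (s : seq T) : s != [::] ->
  exists2 x, x \in s & forall y, y \in s -> h y <= h x.
Proof.
elim: s => // x s IH _; have [->|/IH[y ys yP]] := eqVneq s [::].
  by exists x; rewrite ?mem_head // => y; rewrite inE => /eqP->.
have [xy|yx] := leP (h x) (h y).
  exists y; rewrite ?inE ?ys ?orbT // => z; rewrite inE => /predU1P[->//|].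
  exact: yP.
exists x; rewrite ?mem_head // => z; rewrite inE => /predU1P[->//|/yP zy].
exact: le_trans zy (ltW yx).
Qed.

Section RepresentationRing.
Variables (k : numFieldType) (n : nat).

Lemma RTval_sum (T : Type) (s : seq T) (F : T -> RT k n) t :
  RTval (\sum_(i <- s) F i) t = \sum_(i <- s) RTval (F i) t.
Proof. by elim/big_rec2: _ => // i y z _ <-. Qed.

(** Normalised representatives make the listed characters pairwise distinct on T; some coefficients
    may still be 0. *)
Lemma RT_char_sum (r : RT k n) : exists (ls : seq 'rV[int]_n.+1) (g : 'rV[int]_n.+1 -> int),
  [/\ uniq ls, forall l, l \in ls -> wnorm l = l
    & r = \sum_(l <- ls) (RTchar k l *~ g l)].
Proof.
case: r => f fP; have /asboolP[s fs] := fP.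
pose g l := \sum_(c <- s | wnorm c.2 == l) c.1.
exists (undup [seq wnorm c.2 | c <- s]), g; split; first exact: undup_uniq.
  by move=> l; rewrite mem_undup => /mapP[c _ ->]; rewrite wnormK.
apply: val_inj; apply/funext => t /=.
rewrite RTval_sum fs (big_fibers _ (fun c => wnorm c.2)).
apply: eq_bigr => l _.
have -> : RTval (RTchar k l *~ g l) t = (g l)%:~R * mon l (tval t).
  have valN m : RTval (RTchar k l *+ m) t = m%:R * mon l (tval t).
    elim: m => [|m IH]; first by rewrite mul0r.
    by rewrite mulrS -natr1 mulrDl mul1r addrC -IH.
  case: (g l) => m; first exact: valN.
  transitivity (- RTval (RTchar k l *+ m.+1) t); first by rewrite NegzE mulrNz.
  by rewrite valN NegzE mulrNz mulNr.
rewrite rmorph_sum mulr_suml; apply: eq_bigr => c /eqP <-.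
by rewrite mon_wnorm.
Qed.

Lemma RTcharD l m : RTchar k (l + m) = RTchar k l * RTchar k m :> RT k n.
Proof. by apply: val_inj; apply/funext => t; apply: mon_torusD. Qed.

Lemma RTchar0 : RTchar k 0 = 1 :> RT k n.
Proof. by apply: val_inj; apply/funext => t; apply: mon0. Qed.

End RepresentationRing.

(** * Functionals on the Grothendieck group *)

Section Grothendieck.
Variables (k : numFieldType) (n : nat) (K : comAlgType (RT k n)).
Variables (cls : eqcoh k n -> K) (hK : is_KT cls).

Lemma KT_ext (B : zmodType) (f g : K -> B) :
  {morph f : x y / x + y} -> {morph g : x y / x + y} ->
  (forall E, f (cls E) = g (cls E)) -> f = g.
Proof.
move=> fD gD fg.
have [|h [_ hu]] := KT_universal hK (phi := fun E => f (cls E)).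
  by move=> E F G /(KT_additive hK) ->; rewrite fD.
by rewrite -(hu f); [apply: hu; split=> // E; rewrite fg | split].
Qed.

Lemma KT_functional (B : zmodType) (phi : eqcoh k n -> B) : additive_on_exact phi ->
  exists2 f : K -> B, {morph f : x y / x + y} & forall E, f (cls E) = phi E.
Proof. by move=> /(KT_universal hK)[f [[fD fE] _]]; exists f. Qed.

Section Additive.
Variables (B : zmodType) (f : K -> B).
Hypothesis fD : {morph f : x y / x + y}.
Lemma morph0 : f 0 = 0.
Proof. by apply: (@addrI _ (f 0)); rewrite -fD !addr0. Qed.
Lemma morphN x : f (- x) = - f x.
Proof. by apply: (@addrI _ (f x)); rewrite -fD !subrr morph0. Qed.
Lemma morphMz x z : f (x *~ z) = f x *~ z.
Proof.
have fn m : f (x *+ m) = f x *+ m.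
  by elim: m => [|m IH]; rewrite ?morph0 // !mulrS fD IH.
case: z => m; first exact: fn.
by rewrite NegzE !mulrNz morphN fn.
Qed.
End Additive.

(** The last two properties hold on classes of sheaves and extend to K by the uniqueness in the
    universal property. *)
Lemma weight_functionals : exists f : chart n -> 'rV[int]_n.+1 -> K -> int,
  [/\ forall I m, {morph f I m : x y / x + y},
      forall I m E, f I m (cls E) = hdim E I m,
      forall I m m', wnorm m = wnorm m' -> f I m = f I m'
    & forall I m l x, f I m (RTchar k l *: x) = f I (m - l) x].
Proof.
have /choice[f fP] (Im : chart n * 'rV[int]_n.+1) : exists f : K -> int,
    {morph f : x y / x + y} /\ forall E, f (cls E) = hdim E Im.1 Im.2.
  by have [f] := KT_functional (@hdim_additive k n Im.1 Im.2); exists f.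
have fD I m : {morph f (I, m) : x y / x + y} by case: (fP (I, m)).
have fE I m E : f (I, m) (cls E) = hdim E I m by case: (fP (I, m)) => _ ->.
exists (fun I m => f (I, m)); split=> // [I m m' mm|I m l].
  by apply: KT_ext => // E; rewrite !fE; apply: hdim_wnorm.
suff E : (fun x => f (I, m) (RTchar k l *: x)) = f (I, m - l) by move=> x; rewrite -E.
apply: KT_ext => [x y|//|E]; first by rewrite scalerDr fD.
by rewrite -(KT_twist hK) !fE hdim_twist.
Qed.

(* An extreme weight of a nonzero scalar survives in the product. *)
Lemma scalar_eq0 (f : 'rV[int]_n.+1 -> K -> int) (w : 'I_n.+1) (r : RT k n) (x : K) :
  (forall m, {morph f m : x y / x + y}) ->
  (forall m m', wnorm m = wnorm m' -> f m = f m') ->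
  (forall m l x, f m (RTchar k l *: x) = f (m - l) x) ->
  f 0 x != 0 -> (forall m, 0 <= height w m -> wnorm m != 0 -> f m x = 0) ->
  (forall m, f m (r *: x) = 0) -> r = 0.
Proof.
move=> fD fwn fZ fx0 fx rx0.
have [ls [g [lsu lsn rE]]] := RT_char_sum r.
have [g0|] := eqVneq [seq l <- ls | g l != 0] [::].
  rewrite rE big_seq big1 // => l lls.
  have : l \notin [seq l <- ls | g l != 0] by rewrite g0.
  by rewrite mem_filter lls andbT negbK => /eqP->.
(* Take l of greatest height with nonzero coefficient and test with [f l]. The term of l gives
   [f 0 x]; another l' gives [f (l - l') x], which vanishes because l - l' has nonnegative height
   and is a nontrivial weight. *)
move=> /(seq_argmax (height w))[l]; rewrite mem_filter => /andP[gl lls] lmax.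
have := rx0 l; rewrite rE scaler_suml.
rewrite (big_morph _ (fD l) (morph0 (fD l))) (bigD1_seq l) //=.
rewrite big_seq_cond big1 => [|l' /andP[l'ls l'l]].
  rewrite addr0 -scalerMzl (morphMz (fD l)) fZ subrr => /eqP.
  by rewrite -mulrzr mulf_eq0 (negPf fx0) intr_eq0 (negPf gl).
rewrite -scalerMzl (morphMz (fD l)) fZ.
have [->|gl'] := eqVneq (g l') 0; first by rewrite mulr0z.
rewrite fx ?mul0rz //.
  by rewrite heightB subr_ge0 lmax // mem_filter gl'.
by rewrite wnormB !lsn // subr_eq0 eq_sym.
Qed.

Lemma xi_independent (c : 'I_n.+1 -> RT k n) :
  \sum_w c w *: xi cls w = 0 -> forall w, c w = 0.
Proof.
have [f [fD fE fwn fZ]] := weight_functionals.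
move=> sum0 w; have [N] := ubnP w; elim: N w => // N IH w wN.
have fxi I m u : f I m (xi cls u) = hdim (OX k n u) I m - hdim (OX k n u.+1) I m.
  by rewrite /xi fD (morphN (fD _ _)) !fE.
have fxiw m : f (chart1 w) m (xi cls w) = hdim (OX k n w) (chart1 w) m.
  by rewrite fxi (hdim_OX_lt _ _ (ltnSn w)) subr0.
apply: (@scalar_eq0 (f (chart1 w)) w _ (xi cls w)) => //.
- exact: fwn.
- by rewrite fxiw hdim_OX_0.
- by move=> m hm m0; rewrite fxiw hdim_OX_height.
move=> m; have := congr1 (f (chart1 w) m) sum0.
rewrite (morph0 (fD _ _)) (bigD1 w) //= fD => <-.
rewrite (big_morph _ (fD _ m) (morph0 (fD _ m))) [X in _ + X]big1 ?addr0 // => u uw.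
have [ult|wu] := ltnP u w.
  by rewrite IH ?scale0r ?(morph0 (fD _ _)) // (leq_trans ult).
have {uw}wu : (w < u)%N by rewrite ltn_neqAle wu andbT eq_sym.
(* The functionals are not R(T)-linear: a character shifts the weight. Hence c_u is expanded in
   characters, and each term vanishes since X^u and X^{u+1} miss the chart of w. *)
have [ls [g [_ _ ->]]] := RT_char_sum (c u).
rewrite scaler_suml (big_morph _ (fD _ m) (morph0 (fD _ m))) big1 // => l _.
rewrite -scalerMzl (morphMz (fD _ _)) fZ fxi !hdim_OX_lt ?subrr ?mul0rz //.
exact: ltnW.
Qed.

End Grothendieck.

(** * Twisting by O(-1) *)

Section Serre.
Variables (k : numFieldType) (n : nat).
Implicit Types (E F G H : eqcoh k n) (I J L : chart n).

(** The coordinate x_(base I) is invertible on U_I and trivialises O(-1) there. The choices on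
    different charts differ, whence the transition functions [trans]. *)
Definition base I : 'I_n.+1 := odflt ord0 [pick i in cset I].

Lemma base_in I : base I \in cset I.
Proof.
rewrite /base; case: pickP => //= I0.
by case: I I0 => I /= /set0Pn[i iI] /(_ i); rewrite iI.
Qed.

Lemma base_sub I J : cset I \subset cset J -> base I \in cset J.
Proof. by move=> IJ; apply: (fintype.subsetP IJ); apply: base_in. Qed.

Lemma allowed_ratio I i j : i \in cset I -> allowed I (eps j - eps i).
Proof.
move=> iI; apply/andP; split.
  under eq_bigr do rewrite !mxE !eqxx /=.
  rewrite sumrB (bigD1 j) //= eqxx big1 ?addr0 => [|l /negPf-> //].
  by rewrite (bigD1 i) //= eqxx big1 ?addr0 ?subrr // => l /negPf->.
apply/forallP => l; apply/implyP => lI; rewrite !mxE eqxx /=.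
by have [li|_] := eqVneq l i; [rewrite li iI in lI | rewrite subr0].
Qed.

Definition trans I J : A k J := xmon k J (eps (base J) - eps (base I)).

Section Twist.
Variable E : eqcoh k n.

(* E(-1).  A section s of E over U_I stands for s / x_(base I). *)
Definition serre_res I J (IJ : cset I \subset cset J) (s : E I) : E J :=
  trans I J *: res IJ s.

(** With (t . f)(x) = f(t^-1 x), the function 1 / x_i has weight eps_i. *)
Definition serre_act t I (s : E I) : E I :=
  cstA I (mon (eps (base I)) (tval t)) *: act t s.

Lemma serre_res_linear I J (IJ : cset I \subset cset J) a s s' :
  serre_res IJ (a *: s + s') = restrA IJ a *: serre_res IJ s + serre_res IJ s'.
Proof.
rewrite /serre_res res_linear scalerDr !scalerA.
by congr (_ *: _ + _); apply: mulrC.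
Qed.

Lemma serre_res_id I (II : cset I \subset cset I) s : serre_res II s = s.
Proof. by rewrite /serre_res res_id /trans subrr xmon0 scale1r. Qed.

Lemma serre_res_comp I J L (IJ : cset I \subset cset J)
    (JL : cset J \subset cset L) (IL : cset I \subset cset L) s :
  serre_res JL (serre_res IJ s) = serre_res IL s.
Proof.
rewrite /serre_res resZ scalerA (res_comp IJ JL IL); congr (_ *: _).
have aJ := allowed_ratio (base J) (base_sub IJ).
rewrite /trans restrA_xmon // xmonD ?(allowedS JL) ?allowed_ratio ?base_sub //.
by rewrite addrA subrK.
Qed.

Lemma transK I J : cset I \subset cset J ->
  xmon k J (eps (base I) - eps (base J)) * trans I J = 1.
Proof.
move=> IJ; rewrite /trans xmonD ?allowed_ratio ?base_sub ?base_in //.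
by rewrite addrA subrK subrr xmon0.
Qed.

Lemma serre_res_ker I J (IJ : cset I \subset cset J) i (iI : i \in cset I) s :
  serre_res IJ s = 0 -> exists N : nat, denom J iI ^+ N *: s = 0.
Proof.
move=> /(congr1 ( *:%R (xmon k J (eps (base I) - eps (base J))))).
by rewrite scaler0 scalerA transK // scale1r => /(res_ker iI).
Qed.

Lemma serre_res_im I J (IJ : cset I \subset cset J) i (iI : i \in cset I) (s : E J) :
  exists (N : nat) (s' : E I),
    serre_res IJ s' = restrA IJ (denom J iI) ^+ N *: s.
Proof.
have [N [s' E']] := res_im IJ iI (xmon k J (eps (base I) - eps (base J)) *: s).
exists N, s'; rewrite /serre_res E' !scalerA; congr (_ *: _).
by rewrite mulrAC [trans I J * _]mulrC transK // mul1r.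
Qed.

Lemma serre_act_semilinear t I a s s' :
  serre_act t (a *: s + s') = tactR t a *: serre_act t s + serre_act t s' :> E I.
Proof.
rewrite /serre_act act_semilinear scalerDr !scalerA.
by congr (_ *: _ + _); apply: mulrC.
Qed.

Lemma serre_act1 I (s : E I) : serre_act (torus1 k n) s = s.
Proof. by rewrite /serre_act act1 mon_one cstA1 scale1r. Qed.

Lemma serre_actM t t' I (s : E I) :
  serre_act (torusM t t') s = serre_act t (serre_act t' s).
Proof. by rewrite /serre_act actM actZ tactR_cst scalerA cstAM mon_torusM. Qed.

Lemma serre_act_res t I J (IJ : cset I \subset cset J) s :
  serre_act t (serre_res IJ s) = serre_res IJ (serre_act t s).
Proof.
rewrite /serre_act /serre_res actZ act_res resZ !scalerA; congr (_ *: _).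
rewrite tactR_xmon ?allowed_ratio ?base_sub // mulrA cstAM -mon_torusD mulrC.
rewrite opprB addrCA subrr addr0. by congr (_ * _); apply/regP.
Qed.

Lemma serre_rational I (s : E I) :
  exists w : seq ('rV[int]_n.+1 * E I),
    forall t, serre_act t s = \sum_(c <- w) cstA I (mon c.1 (tval t)) *: c.2.
Proof.
have [w ws] := act_rational s.
exists [seq (eps (base I) + c.1, c.2) | c <- w] => t.
rewrite big_map /serre_act ws scaler_sumr; apply: eq_bigr => c _ /=.
by rewrite scalerA cstAM mon_torusD.
Qed.

Definition serre : eqcoh k n := EqCoh serre_res_linear serre_res_id serre_res_comp
  serre_res_ker serre_res_im (@sec_fg k n E) serre_act_semilinear serre_act1
  serre_actM serre_act_res serre_rational.
End Twist.

Lemma is_homZ E F (f : forall I, E I -> F I) I a s :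
  is_hom f -> f I (a *: s) = a *: f I s.
Proof.
case=> fl _ _.
have f0 : f I 0 = 0.
  have := fl I 1 0 0; rewrite !scale1r addr0 => /esym/eqP.
  by rewrite -subr_eq0 addrK => /eqP.
by rewrite -[a *: s]addr0 fl f0 addr0.
Qed.

Lemma serre_hom E F (f : forall I, E I -> F I) : is_hom f ->
  is_hom (f : forall I, serre E I -> serre F I).
Proof.
move=> fh; have [fl fr fa] := fh; split=> // [I J IJ s|t I s].
  by rewrite /= /serre_res (is_homZ _ _ fh) fr.
by rewrite /= /serre_act (is_homZ _ _ fh) fa.
Qed.

Lemma serre_exact E F G : short_exact E F G -> short_exact (serre E) (serre F) (serre G).
Proof. by move=> [f [g [fh gh fg]]]; exists f, g; split=> //; apply: serre_hom. Qed.

(** The modules of E(-1) over the charts are those of E; only restriction and the action of T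
    change. *)
Lemma serre_vector_bundle E : vector_bundle E -> vector_bundle (serre E).
Proof. by []. Qed.

Lemma is_bilinearZl I (M N P : lmodType (A k I)) (b : M -> N -> P) a s s' :
  is_bilinear b -> b (a *: s) s' = a *: b s s'.
Proof.
case=> _ /(_ s') bl; have b0 : b 0 s' = 0.
  have := bl 1 0 0; rewrite !scale1r addr0 => /esym/eqP.
  by rewrite -subr_eq0 addrK => /eqP.
by rewrite -[a *: s]addr0 bl b0 addr0.
Qed.

Lemma is_bilinearZr I (M N P : lmodType (A k I)) (b : M -> N -> P) a s s' :
  is_bilinear b -> b s (a *: s') = a *: b s s'.
Proof. by case=> bl br; apply: (@is_bilinearZl I N M P (fun x y => b y x)); split. Qed.

(** The same bilinear maps serve, since their universal property is stated chart by chart. *)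
Lemma serre_tensorl E F H : is_tensor E F H -> is_tensor (serre E) F (serre H).
Proof.
move=> [b [bl br ba bu]]; exists b; split=> // [I J IJ s s'|t I s s'].
  by rewrite /= /serre_res br is_bilinearZl.
by rewrite /= /serre_act ba is_bilinearZl.
Qed.

Lemma serre_tensorr E F H : is_tensor E F H -> is_tensor E (serre F) (serre H).
Proof.
move=> [b [bl br ba bu]]; exists b; split=> // [I J IJ s s'|t I s s'].
  by rewrite /= /serre_res br is_bilinearZr.
by rewrite /= /serre_act ba is_bilinearZr.
Qed.

Lemma OX0_vector_bundle : vector_bundle (OX k n 0).
Proof.
move=> I; exists 1%N, (fun=> 1), (fun=> 1); split; first by rewrite big_ord1 mulr1.
move=> _; exists 1%N, (fun=> 1 : reg k 0 I); split=> [m|c].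
  exists 0%N, (fun=> m); rewrite big_ord1 expr0 scale1r.
  by apply/regP => x; rewrite reg_scaleE mulr1; congr (rval m _); apply: val_inj.
rewrite big_ord1 => c0; exists 0%N => i; rewrite expr0 mul1r ord1.
apply/regP => x; have := congr1 (fun f : reg k 0 I => rval f x) c0.
rewrite reg_scaleE mulr1 => <-; congr (rval _ _); exact: val_inj.
Qed.

Lemma OX0_tensor : is_tensor (OX k n 0) (OX k n 0) (OX k n 0).
Proof.
have scaleE I (a b : reg k 0 I) : (a : A k I) *: b = a * b.
  by apply/regP => x; rewrite reg_scaleE rvalM; congr (rval a _ * _); apply: val_inj.
exists (fun I (s s' : reg k 0 I) => s * s'); split.
- move=> I; split=> m a s s'; rewrite !scaleE; first by rewrite mulrDr mulrCA.
  by rewrite mulrDl mulrA.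
- by move=> I J IJ s s'; apply/regP.
- by move=> t I s s'; apply/regP.
move=> I P c cb; exists (fun s : reg k 0 I => c 1 s); split.
  split=> [a s s'|s s']; first exact: (cb.1 1).
  rewrite -scaleE (is_bilinearZr _ _ _ cb) -(is_bilinearZl _ _ _ cb).
  by rewrite scaleE mulr1.
move=> l [ll lE]; apply/funext => s.
by rewrite -lE mul1r.
Qed.

End Serre.

(** * The ideal sheaf of X^{u+1} in X^u *)

(** In characteristic 0 the numbers 1, ..., [size p] are distinct nonzero roots, too many for a
    nonzero [p]. *)
Lemma poly_eq0_punctured (k : numFieldType) (p : {poly k}) :
  (forall z, z != 0 -> p.[z] = 0) -> p = 0.
Proof.
move=> p0; apply: (@roots_geq_poly_eq0 _ p [seq j.+1%:R | j <- iota 0 (size p)]).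
- by apply/allP => _ /mapP[j _ ->]; rewrite rootE p0 ?pnatr_eq0.
- by rewrite map_inj_uniq ?iota_uniq // => i j /eqP; rewrite eqr_nat => /eqP[].
- by rewrite size_map size_iota.
Qed.

Section HyperplaneSection.
Variables (k : numFieldType) (n : nat).
Implicit Types (I J : chart n) (u : 'I_n.+1) (m : 'rV[int]_n.+1).

Definition set_coord u (x : 'rV[k]_n.+1) (z : k) : 'rV[k]_n.+1 :=
  \row_j (if j == u then z else x 0 j).

Lemma mon_set_coord u m x z :
  mon m (set_coord u x z) = z ^ m 0 u * \prod_(j | j != u) x 0 j ^ m 0 j.
Proof.
rewrite /mon (bigD1 u) //= mxE eqxx; congr (_ * _).
by apply: eq_bigr => j /negPf ju; rewrite mxE ju.
Qed.

Lemma set_coord_id u x : set_coord u x (x 0 u) = x.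
Proof. by apply/rowP => j; rewrite mxE; case: eqP => // ->. Qed.

Lemma set_coord_in_chart u I z (x : pt k u I) : u \notin cset I ->
  in_chart u I (set_coord u (val x) z).
Proof.
move=> uI; have /andP[/forallP x0 /forallP xI] := valP x.
apply/andP; split; apply/forallP => j; apply/implyP => jP; rewrite mxE.
  by rewrite ifN ?(implyP (x0 j)) //; apply: contraTneq jP => ->; rewrite ltnn.
by rewrite ifN ?(implyP (xI j)) //; apply: contraNneq uI => <-.
Qed.

Lemma set_coord0_in_chart u I (x : pt k u I) : u \notin cset I ->
  in_chart u.+1 I (set_coord u (val x) 0).
Proof.
move=> uI; have /andP[/forallP x0 xI] := set_coord_in_chart 0 x uI.
apply/andP; split=> //; apply/forallP => j; apply/implyP.
rewrite ltnS leq_eqVlt => /orP[/eqP/val_inj->|/(implyP (x0 j)) //].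
by rewrite mxE eqxx.
Qed.

(** If u is in I, coordinate u never vanishes on the chart. Otherwise s is polynomial in this
    coordinate with the others fixed, so vanishing away from 0 forces vanishing at 0. *)
Lemma reg_eq0_generic u I (s : reg k u I) :
  (forall x : pt k u I, val x 0 u != 0 -> rval s x = 0) -> s = 0.
Proof.
move=> s0; apply/regP => x; rewrite rval0.
have [xu|/s0 //] := eqVneq (val x 0 u) 0.
have uI : u \notin cset I.
  apply/negP => uI; have /andP[_ /forallP/(_ u)/implyP/(_ uI)] := valP x.
  by rewrite xu eqxx.
have [L [LI sL]] := regular_sum s.
(* The exponents of x_u are nonnegative because u is not in I, so [absz] loses nothing. *)
pose p : {poly k} := \sum_(c <- L)
  (c.1 * \prod_(j | j != u) val x 0 j ^ c.2 0 j) *: 'X^(absz (c.2 0 u)).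
have pE z : p.[z] = rval s (Sub _ (set_coord_in_chart z x uI)).
  rewrite sL /p horner_sum; apply: eq_big_seq => c /(allP LI) cI.
  rewrite hornerZ hornerXn /= mon_set_coord -mulrA; congr (_ * _).
  rewrite mulrC; congr (_ * _).
  have /andP[_ /forallP/(_ u)/implyP/(_ uI)] := cI.
  by case: (c.2 0 u).
have p0 : p = 0.
  apply: poly_eq0_punctured => z z0; rewrite pE s0 //=.
  by rewrite mxE eqxx.
have := pE 0; rewrite p0 horner0 => ->; congr (rval s _); apply: val_inj => /=.
by rewrite -xu set_coord_id.
Qed.

Lemma mon_ratio (x : 'rV[k]_n.+1) i j : x 0 i != 0 ->
  mon (eps j - eps i) x = x 0 j / x 0 i.
Proof.
move=> xi; have [->|ji] := eqVneq j i; first by rewrite subrr mon0 divff.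
rewrite /mon (bigD1 j) //= (bigD1 i) /=; last by rewrite eq_sym.
rewrite big1 => [|l /andP[/negPf lj /negPf li]]; last by rewrite !mxE lj li andbF expr0z.
rewrite !mxE !eqxx [i == j]eq_sym (negPf ji) /= subr0 sub0r expr1z mulr1.
by rewrite exprN1.
Qed.

Lemma base_neq0 u I (x : pt k u I) : val x 0 (base I) != 0.
Proof. by have /andP[_ /forallP/(_ (base I))/implyP/(_ (base_in I))] := valP x. Qed.

(** Multiplication by x_u, written in the trivialisation where s stands for s / x_(base I). *)
Definition coord_mul u I (s : reg k u I) : reg k u I :=
  xmon k I (eps u - eps (base I)) *: s.

Lemma coord_mulE u I (s : reg k u I) x :
  rval (coord_mul s) x = val x 0 u / val x 0 (base I) * rval s x.
Proof.
rewrite reg_scaleE xmonE ?allowed_ratio ?base_in // mon_ratio //.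
exact: base_neq0.
Qed.

Lemma leSu u I : (u <= u.+1)%N && (cset I \subset cset I).
Proof. by rewrite leqnSn /=. Qed.

Definition OX_restr u I (s : reg k u I) : reg k u.+1 I := restr (leSu u I) s.

(** The coordinate x_u has weight -eps_u, which the twist of the source compensates. *)
Lemma coord_mul_hom u : is_hom (E := twist (- eps u) (serre (OX k n u)))
  (F := OX k n u) (fun I => @coord_mul u I).
Proof.
split=> [I a s s'|I J IJ s|t I s].
- rewrite /coord_mul scalerDr !scalerA.
  by congr (_ *: _ + _); apply: mulrC.
- pose s' : reg k u J := @res k n (OX k n u) I J IJ s.
  transitivity (xmon k J (eps u - eps (base J)) *: (trans k I J *: s')); first by [].
  transitivity (restrA IJ (xmon k I (eps u - eps (base I))) *: s'); last first.
    by rewrite -(@resZ k n (OX k n u)).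
  rewrite scalerA restrA_xmon ?allowed_ratio ?base_in //; congr (_ *: _).
  by rewrite /trans xmonD ?allowed_ratio ?base_sub ?base_in // addrA subrK.
- pose s' : reg k u I := @act k n (OX k n u) t I s.
  transitivity (xmon k I (eps u - eps (base I)) *: (cstA I (mon (- eps u) (tval t)) *:
    (cstA I (mon (eps (base I)) (tval t)) *: s'))); first by [].
  transitivity (tactR t (xmon k I (eps u - eps (base I))) *: s'); last first.
    by rewrite -(@actZ k n (OX k n u)).
  rewrite !scalerA tactR_xmon ?allowed_ratio ?base_in //; congr (_ *: _).
  rewrite opprB [eps (base I) - _]addrC mon_torusD -cstAM.
  by rewrite -mulrA mulrC.
Qed.

Lemma OX_restr_hom u : is_hom (E := OX k n u) (F := OX k n u.+1)
  (fun I => @OX_restr u I).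
Proof.
split=> [I a s s'|I J IJ s|t I s]; apply/regP => x.
- rewrite [LHS](_ : _ = rval (a *: (s : reg k u I) + s' : reg k u I) (pt_incl (leSu u I) x)) //.
  rewrite !rvalD !reg_scaleE; congr (_ * _ + _).
  by congr (rval a _); apply: val_inj.
- by congr (rval s _); apply: val_inj.
- by congr (rval s _); apply: val_inj.
Qed.

Lemma coord_mul_inj u I : injective (@coord_mul u I).
Proof.
move=> s s' E; apply/eqP; rewrite -subr_eq0; apply/eqP.
apply: reg_eq0_generic => x xu; have := congr1 (fun f => rval f x) E.
rewrite !coord_mulE => /mulfI E'.
rewrite [LHS](_ : _ = rval s x - rval s' x) // E' ?subrr //.
by rewrite mulf_neq0 ?invr_neq0 ?base_neq0.
Qed.

Lemma OX_restr_surj u I (s : reg k u.+1 I) : exists s', OX_restr s' = s.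
Proof.
have [L [LI sL]] := regular_sum s.
have rP : (fun x : pt k u I => \sum_(c <- L) c.1 * mon c.2 (val x)) \in @regular k n u I.
  by apply/asboolP; exists L.
by exists (Reg rP); apply/regP => x; rewrite sL.
Qed.

(** If u is in I, x_u is invertible on U_I. Otherwise the monomials of s that contain x_u are
    divisible by it, and the sum of the others is the value of s at the projection to x_u = 0, where
    s vanishes. *)
Lemma OX_restr_ker u I (s : reg k u I) :
  OX_restr s = 0 <-> exists s', coord_mul s' = s.
Proof.
split=> [s0|[s' <-]]; last first.
  apply/regP => x; rewrite [LHS]coord_mulE /=.
  have /andP[/forallP/(_ u)/implyP/(_ (ltnSn u))/eqP -> _] := valP x.
  by rewrite !mul0r.
have [uI|uI] := boolP (u \in cset I).
  exists (xmon k I (eps (base I) - eps u) *: s).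
  rewrite /coord_mul scalerA xmonD ?allowed_ratio ?base_in //.
  by rewrite addrA subrK subrr xmon0 scale1r.
have [L [LI sL]] := regular_sum s.
pose L1 := [seq (c.1, c.2 - (eps u - eps (base I))) |
  c <- [seq c : k * 'rV[int]_n.+1 <- L | c.2 0 u != 0]].
have L1I : all (fun c => allowed I c.2) L1.
  apply/allP => _ /mapP[c + ->] /=; rewrite mem_filter => /andP[cu /(allP LI) cI].
  have /andP[/eqP c0 /forallP cp] := cI.
  have /andP[/eqP e0 _] := allowed_ratio u (base_in I).
  apply/andP; split.
    by under eq_bigr do rewrite mxE [X in _ + X]mxE; rewrite sumrB c0 e0 subrr.
  apply/forallP => j; apply/implyP => jI; have := implyP (cp j) jI.
  rewrite !mxE eqxx /=; have -> : (j == base I) = false.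
    by apply: contraNF jI => /eqP->; apply: base_in.
  rewrite subr0; have [->|_] := eqVneq j u; last by rewrite subr0.
  by rewrite subr_ge0 -gtz0_ge1 lt_neqAle eq_sym cu.
have rP : (fun x : pt k u I => \sum_(c <- L1) c.1 * mon c.2 (val x)) \in @regular k n u I.
  by apply/asboolP; exists L1.
exists (Reg rP); apply/regP => x.
have s1E : rval (coord_mul (Reg rP)) x = \sum_(c <- L | c.2 0 u != 0) c.1 * mon c.2 (val x).
  rewrite reg_scaleE xmonE ?allowed_ratio ?base_in //= big_map big_filter_cond /=.
  rewrite mulr_sumr big_seq_cond [RHS]big_seq_cond.
  apply: eq_big => [c|c /andP[cL /andP[cu _]]]; first by rewrite andbT.
  have cI : allowed I (c.2 - (eps u - eps (base I))).
    apply: (allP L1I (c.1, c.2 - (eps u - eps (base I)))).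
    by apply/mapP; exists c => //; rewrite mem_filter cu.
  rewrite /= mulrCA -(monD x (allowed_ratio u (base_in I)) cI).
  by rewrite addrC subrK.
rewrite s1E sL [RHS](bigID (fun c : k * 'rV[int]_n.+1 => c.2 0 u != 0)) /=.
pose y : pt k u I := Sub _ (set_coord_in_chart 0 x uI).
have : rval s y = 0.
  have := congr1 (fun f : reg k u.+1 I => rval f (Sub _ (set_coord0_in_chart x uI))) s0.
  by rewrite rval0 /= => sy; rewrite -sy; congr (rval s _); apply: val_inj.
rewrite sL (bigID (fun c : k * 'rV[int]_n.+1 => c.2 0 u != 0)) /= big1 ?add0r => [sy|c cu]; last first.
  by rewrite mon_set_coord exp0rz (negPf cu) mul0r mulr0.
rewrite -[LHS]addr0; congr (_ + _); rewrite -[LHS]sy; apply: eq_bigr => c.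
rewrite negbK => /eqP cu; rewrite mon_set_coord cu expr0z mul1r.
by rewrite /mon [X in _ = _ * X](bigD1 u) //= cu expr0z mul1r.
Qed.


Lemma OX_exact u :
  short_exact (twist (- eps u) (serre (OX k n u))) (OX k n u) (OX k n u.+1).
Proof.
exists (fun I => @coord_mul u I), (fun I => @OX_restr u I); split=> [||I].
- exact: coord_mul_hom.
- exact: OX_restr_hom.
- by split; [apply: coord_mul_inj | apply: OX_restr_ker | apply: OX_restr_surj].
Qed.

End HyperplaneSection.

(** * Computation in K_T(P^n) *)

Section ClassesInK.
Variables (k : numFieldType) (n : nat) (K : comAlgType (RT k n)).
Variables (cls : eqcoh k n -> K) (hK : is_KT cls).
Implicit Types (E F : eqcoh k n) (I : chart n).

Lemma OX_top_trivial (I : chart n) (s : reg k n.+1 I) : s = 0.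
Proof.
apply/regP => x.
have /andP[/forallP x0 /forallP/(_ (base I))/implyP/(_ (base_in I))] := valP x.
by rewrite (eqP (implyP (x0 (base I)) (ltn_ord _))) eqxx.
Qed.

Lemma OX_hom E : is_hom (E := E) (F := OX k n n.+1) (fun I _ => 0 : reg k n.+1 I).
Proof.
split=> [I a s s'|I J IJ s|t I s]; apply: etrans (OX_top_trivial _) _;
  exact/esym/OX_top_trivial.
Qed.

(** Identity maps make three copies of the zero sheaf an exact sequence, so its class c satisfies c
    = c + c. *)
Lemma cls_OX_top : cls (OX k n n.+1) = 0.
Proof.
apply/esym/(@addrI _ (cls (OX k n n.+1))); rewrite addr0.
apply: (KT_additive hK); exists (fun I s => s), (fun I s => s); split=> // I.
split=> // [s|s]; last by exists s.
by split=> [_|_]; [exists s | apply: OX_top_trivial].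
Qed.

Lemma cls_iso E F (f : forall I, E I -> F I) : is_hom f ->
  (forall I, bijective (f I)) -> cls E = cls F.
Proof.
move=> fh fb; have := KT_additive hK (E := E) (F := F) (G := OX k n n.+1) _.
rewrite cls_OX_top addr0 => -> //.
exists f, (fun I _ => 0 : reg k n.+1 I); split=> //; first exact: OX_hom.
move=> I; have [g gK fK] := fb I; split.
- exact: can_inj gK.
- by move=> s; split=> // _; exists (g s); rewrite fK.
- by move=> s; exists 0; rewrite [s]OX_top_trivial.
Qed.

Lemma cls_serre_twist l E : cls (serre (twist l E)) = RTchar k l *: cls (serre E).
Proof.
rewrite -(KT_twist hK).
apply: (@cls_iso (serre (twist l E)) (twist l (serre E)) (fun I (s : E I) => s)) => [|I]; last by exists id.
split=> // t I s; rewrite /= /serre_act /= /twist_act /= !scalerA.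
by congr (_ *: _); apply: mulrC.
Qed.

Lemma morphZ (B : lmodType (RT k n)) (f : K -> B) : {morph f : x y / x + y} ->
  (forall l x, f (RTchar k l *: x) = RTchar k l *: f x) ->
  forall r x, f (r *: x) = r *: f x.
Proof.
move=> fD fZ r x; have [ls [g [_ _ ->]]] := RT_char_sum r.
rewrite !scaler_suml (big_morph _ fD (morph0 fD)); apply: eq_bigr => l _.
by rewrite -!scalerMzl (morphMz fD) fZ.
Qed.

Lemma serre_operator : exists tau : K -> K,
  [/\ {morph tau : x y / x + y}, forall r x, tau (r *: x) = r *: tau x
    & forall E, tau (cls E) = cls (serre E)].
Proof.
have [|tau tauD tauE] := KT_functional hK (phi := fun E => cls (serre E)).
  by move=> E F G /serre_exact/(KT_additive hK).
exists tau; split=> //; apply: morphZ => // l.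
suff E : (fun x => tau (RTchar k l *: x)) = (fun x => RTchar k l *: tau x).
  by move=> x; have := congr1 (@^~ x) E.
apply: (KT_ext hK) => [x y|x y|E]; rewrite ?scalerDr ?tauD ?scalerDr //.
by rewrite -(KT_twist hK) !tauE cls_serre_twist.
Qed.

Definition serre_iter j := iter j (@serre k n) (OX k n 0).

Lemma serre_iter_vector_bundle j : vector_bundle (serre_iter j).
Proof. by elim: j => [|j IH]; [apply: OX0_vector_bundle | apply: serre_vector_bundle]. Qed.

Lemma cls_serre_iterM i j :
  cls (serre_iter i) * cls (serre_iter j) = cls (serre_iter (i + j)).
Proof.
apply/esym/(KT_tensor hK); [exact: serre_iter_vector_bundle..|].
elim: i => [|i IH]; last exact: serre_tensorl.
elim: j => [|j IH]; [exact: OX0_tensor | exact: serre_tensorr].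
Qed.

(* The classes of O(-j), j >= 0, and their span: 'X stands for O(-1).  The unit
   of K is not needed, so the factor [cls (OX 0)] is kept throughout. *)
Definition ofpoly (f : {poly RT k n}) : K :=
  cls (OX k n 0) * horner_alg (cls (serre (OX k n 0))) f.

Lemma OX0_idem : cls (OX k n 0) * cls (OX k n 0) = cls (OX k n 0).
Proof. exact: (cls_serre_iterM 0 0). Qed.

Lemma cls_serre_iter j : cls (serre_iter j) = ofpoly 'X^j.
Proof.
rewrite /ofpoly rmorphXn /= horner_algX.
elim: j => [|j IH]; first by rewrite expr0 mulr1.
by rewrite -[j.+1]add1n -cls_serre_iterM IH exprS mulrCA.
Qed.

Lemma ofpolyD f g : ofpoly (f + g) = ofpoly f + ofpoly g.
Proof. by rewrite /ofpoly rmorphD mulrDr. Qed.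
Lemma ofpolyB f g : ofpoly (f - g) = ofpoly f - ofpoly g.
Proof. by rewrite /ofpoly rmorphB mulrBr. Qed.
Lemma ofpolyZ r f : ofpoly (r *: f) = r *: ofpoly f.
Proof. by rewrite /ofpoly linearZ /= mulr_algl -scalerAr. Qed.
Lemma ofpolyM f g : ofpoly (f * g) = ofpoly f * ofpoly g.
Proof. by rewrite /ofpoly rmorphM mulrACA OX0_idem. Qed.
Lemma ofpoly_sum (T : Type) (s : seq T) (F : T -> {poly RT k n}) :
  ofpoly (\sum_(i <- s) F i) = \sum_(i <- s) ofpoly (F i).
Proof. by rewrite /ofpoly rmorph_sum mulr_sumr. Qed.

Definition OXpoly (u : nat) : {poly RT k n} :=
  \prod_(i < u) (1 - RTchar k (- eps (inord i : 'I_n.+1)) *: 'X).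

(** The exact sequence expresses [O_{X^{u+1}}] by [O_{X^u}] and [O_{X^u}(-1)], so both classes are
    carried through the induction. *)
Lemma cls_OX u : (u <= n.+1)%N -> cls (OX k n u) = ofpoly (OXpoly u) /\
  cls (serre (OX k n u)) = ofpoly ('X * OXpoly u).
Proof.
have [tau [tauD tauZ tauE]] := serre_operator.
(* By linearity it suffices to compare on the powers of X, that is on the classes of the O(-j). *)
have tauP f : tau (ofpoly f) = ofpoly ('X * f).
  rewrite -[f]coefK poly_def mulr_sumr !ofpoly_sum (big_morph _ tauD (morph0 tauD)).
  apply: eq_bigr => j _; rewrite -scalerAr !ofpolyZ tauZ; congr (_ *: _).
  by rewrite -cls_serre_iter tauE -exprS -cls_serre_iter.
elim: u => [_|u IH un].
  rewrite /OXpoly big_ord0 mulr1.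
  by split; [apply: (cls_serre_iter 0) | apply: (cls_serre_iter 1)].
have [IH1 IH2] := IH (ltnW un).
have E : cls (OX k n u.+1) = ofpoly (OXpoly u.+1).
  have /(KT_additive hK) := OX_exact k (Ordinal un); rewrite /=.
  rewrite (KT_twist hK) IH1 IH2 addrC => /eqP; rewrite -subr_eq => /eqP <-.
  rewrite /OXpoly big_ord_recr /= mulrBr mulr1 ofpolyB; congr (_ - _).
  rewrite -ofpolyZ -scalerAr mulrC; congr (ofpoly (RTchar k (- eps _) *: _)).
  by apply: val_inj; rewrite /= inordK.
by rewrite E -tauP -E tauE.
Qed.


Definition node (i : nat) : RT k n := RTchar k (eps (inord i)).

Lemma chiS u : (u < n.+1)%N -> chi n u.+1 = chi n u + eps (inord u).
Proof.
move=> un; rewrite /chi (bigD1 (inord u)) ?inordK //= addrC; congr (_ + _).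
apply: eq_bigl => i; rewrite ltnS leq_eqVlt -val_eqE /= inordK //.
by case: ltngtP.
Qed.

Lemma eps_prod_recip u : (u <= n.+1)%N -> eps_prod k n u = recip node u.
Proof.
move=> un; apply/esym.
apply: (etrans (big_ord_widen n.+1 (fun i => 1 - (node i)%:P * 'X) un)).
by apply: eq_bigr => i _; rewrite /node inord_val.
Qed.

Definition xicoef (u : nat) : RT k n := (-1) ^+ u * RTchar k (- chi n u.+1).

Definition xicoefV (u : nat) : RT k n := (-1) ^+ u * RTchar k (chi n u.+1).

Lemma xicoefK u : xicoefV u * xicoef u = 1.
Proof. by rewrite mulrACA -RTcharD subrr RTchar0 mulr1 -expr2 sqrr_sign. Qed.

Lemma OXpoly_newton u : (u <= n.+1)%N ->
  OXpoly u = ((-1) ^+ u * RTchar k (- chi n u)) *: newton node u.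
Proof.
elim: u => [_|u IH un].
  rewrite /OXpoly /newton !big_ord0 /chi big_pred0 // oppr0 RTchar0.
  by rewrite mulr1 scale1r.
rewrite /OXpoly big_ord_recr /= -/(OXpoly u) IH ?(ltnW un) // newtonS.
have -> : 1 - RTchar k (- eps (inord u)) *: 'X =
    - RTchar k (- eps (inord u)) *: ('X - (node u)%:P).
  rewrite scalerBr !scaleNr opprK [RHS]addrC; congr (_ - _).
  by rewrite -mul_polyC -polyCM -RTcharD addNr RTchar0.
rewrite -scalerAl -scalerAr scalerA chiS // opprD RTcharD exprS.
by congr (_ *: _); rewrite mulN1r !mulNr mulrN mulrA.
Qed.

Lemma xi_newton (u : 'I_n.+1) :
  xi cls u = xicoef u *: ofpoly ('X * newton node u).
Proof.
have [E _] := cls_OX (ltnW (ltn_ord u)); have [E' _] := cls_OX (ltn_ord u).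
rewrite /xi E E' -ofpolyB -ofpolyZ /OXpoly big_ord_recr /= -/(OXpoly u).
rewrite mulrBr mulr1 opprB addrCA subrr addr0 OXpoly_newton ?(ltnW (ltn_ord u)) //.
congr ofpoly; rewrite -scalerAl -scalerAr scalerA [newton _ _ * _]mulrC; congr (_ *: _).
by rewrite /xicoef chiS // opprD RTcharD mulrA.
Qed.

(** Up to a unit N_{n+1} is [OXpoly n.+1], which represents the class of the zero sheaf; multiples
    follow because [ofpoly] is multiplicative. *)
Lemma ofpoly_newton_top r : ofpoly (newton node n.+1 * r) = 0.
Proof.
have [] := cls_OX (leqnn n.+1); rewrite cls_OX_top OXpoly_newton // => E _.
have : ofpoly (OXpoly n.+1) = 0.
  by rewrite OXpoly_newton -?E.
move=> {}E; have -> : newton node n.+1 =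
    ((-1) ^+ n.+1 * RTchar k (chi n n.+1)) *: OXpoly n.+1.
  rewrite OXpoly_newton // scalerA mulrACA -RTcharD subrr RTchar0 mulr1 -expr2.
  by rewrite sqrr_sign scale1r.
by rewrite -scalerAl ofpolyZ ofpolyM E mul0r scaler0.
Qed.

(** The product contains X twice: one factor enters the Newton expansion, the other turns each N_w
    back into X N_w, that is into xi^w up to a unit. *)
Lemma xi_mul (u v : 'I_n.+1) : xi cls u * xi cls v =
  \sum_(w < n.+1) (xicoef u * xicoef v * xicoefV w *
     ratio_coef (recip node u * recip node v) (recip node w.+1)
       (u%:Z + v%:Z - w%:Z + 1)) *: xi cls w.
Proof.
rewrite !xi_newton -scalerAl -scalerAr scalerA -ofpolyM.
have [r E] := newton_expansion node u v n.+1.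
have -> : 'X * newton node u * ('X * newton node v) =
    'X * ('X * (newton node u * newton node v)) by rewrite -!mulrA; congr (_ * _); rewrite mulrCA.
rewrite E mulrDr ofpolyD ['X * (newton node n.+1 * r)]mulrCA ofpoly_newton_top addr0 mulr_sumr ofpoly_sum scaler_sumr.
apply: eq_bigr => w _; rewrite xi_newton scalerA.
rewrite mul_polyC -scalerAr ofpolyZ scalerA; congr (_ *: _).
by rewrite [RHS]mulrAC -[_ * xicoefV w * xicoef w]mulrA xicoefK mulr1.
Qed.

Lemma structure_constants (p : 'I_n.+1 -> 'I_n.+1 -> 'I_n.+1 -> RT k n)
    (hp : forall u v : 'I_n.+1,
       xi cls u * xi cls v = \sum_(w < n.+1) p u v w *: xi cls w)
    (u v w : 'I_n.+1) :
  (-1) ^+ (u + v + w) * p u v w =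
    RTchar k (chi n w.+1 - chi n u.+1 - chi n v.+1) *
    ratio_coef (eps_prod k n u * eps_prod k n v) (eps_prod k n w.+1)
      (u%:Z + v%:Z - w%:Z + 1).
Proof.
rewrite !eps_prod_recip ?(ltnW (ltn_ord _)) ?ltn_ord //.
set q := ratio_coef _ _ _.
have -> : p u v w = xicoef u * xicoef v * xicoefV w * q.
  apply/eqP; rewrite -subr_eq0; apply/eqP.
  pose c w := p u v w - xicoef u * xicoef v * xicoefV w *
     ratio_coef (recip node u * recip node v) (recip node w.+1)
       (u%:Z + v%:Z - w%:Z + 1).
  apply: (xi_independent hK (c := c)).
  under eq_bigr do rewrite scalerBl.
  by rewrite sumrB -hp -xi_mul subrr.
rewrite mulrA; congr (_ * _); rewrite /xicoef /xicoefV.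
rewrite !exprD; set a := (-1) ^+ u; set b := (-1) ^+ v; set d := (-1) ^+ w.
have aa : a * a = 1 by rewrite -expr2 sqrr_sign.
have bb : b * b = 1 by rewrite -expr2 sqrr_sign.
have dd : d * d = 1 by rewrite -expr2 sqrr_sign.
rewrite !RTcharD.
transitivity ((a * a) * (b * b) * (d * d) * (RTchar k (chi n w.+1) *
  RTchar k (- chi n u.+1) * RTchar k (- chi n v.+1))); first by ring.
by rewrite aa bb dd !mul1r.
Qed.

End ClassesInK.

Theorem theorem6p7 (R : realType) (n : nat) (hn : (1 <= n)%N)
    (K : comAlgType (RT R[i] n)) (cls : eqcoh R[i] n -> K) (hK : is_KT cls)
    (p : 'I_n.+1 -> 'I_n.+1 -> 'I_n.+1 -> RT R[i] n)
    (hp : forall u v : 'I_n.+1,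
       xi cls u * xi cls v = \sum_(w < n.+1) p u v w *: xi cls w)
    (u v w : 'I_n.+1) :
  (-1) ^+ (u + v + w) * p u v w =
    RTchar R[i] (chi n w.+1 - chi n u.+1 - chi n v.+1) *
    ratio_coef (eps_prod R[i] n u * eps_prod R[i] n v) (eps_prod R[i] n w.+1)
      (u%:Z + v%:Z - w%:Z + 1).
Proof. exact: (structure_constants hK hp). Qed.
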